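(* Let $X$ be a real valued cadlag martingale which is continuous in probability. Then $X$ is almost-continuous if and only if the (random) set $$\left\{(t,x)\in\mathbb{R}_+\times\mathbb{R} : X_{t-}<x<X_t \text{ or } X_t<x<X_{t-}\right\}$$ is almost surely disjoint from the marginal support $\mathrm{MSupp}(X)$ of $X$.
   Context: All processes are indexed by $t\in\mathbb{R}_+=[0,\infty)$ and, unless stated otherwise, are defined with respect to a filtered probability space $(\Omega,\mathcal{F},(\mathcal{F}_t)_{t\in\mathbb{R}_+},\mathbb{P})$. $X_{t-}$ denotes the left limit of $X$ at $t$, with $X_{0-}=X_0$. Almost-continuous: a real valued process $X$ is almost-continuous if it is cadlag, continuous in probability, and given any two independent, identically distributed cadlag processes $Y,Z$ with the same distribution as $X$, for every $s<t$ in $\mathbb{R}_+$, $$\mathbb{P}\left(Y_s<Z_s,\ Y_t>Z_t \text{ and } Y_u\neq Z_u \text{ for every } u\in(s,t)\right)=0.$$ Support: for a real valued random variable $V$, $\mathrm{Supp}(V)$ is the smallest closed subset of $\mathbb{R}$ with $\mathbb{P}(V\in\mathrm{Supp}(V))=1$. Marginal support: $\mathrm{MSupp}(X)=\{(t,x)\in\mathbb{R}_+\times\mathbb{R}: x\in\mathrm{Supp}(X_t)\}$. *)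

(* Defs.v *)
From HB Require Import structures.
From mathcomp Require Import all_boot all_order all_algebra.
From mathcomp Require Import all_classical all_reals all_analysis.

Set Implicit Arguments.
Unset Strict Implicit.
Unset Printing Implicit Defensive.

Import Order.TTheory GRing.Theory Num.Theory.
Import numFieldNormedType.Exports.

Local Open Scope classical_set_scope.
Local Open Scope ring_scope.

(* A real-valued process indexed by [0, +oo) is represented by a family
   X : R -> {RV P >-> R}; every definition below only looks at the times t
   with 0 <= t, so the values of X at negative times are irrelevant. *)

Section paths.
Context {R : realType}.
Implicit Types x : R -> R.

Definition cadlag_path x : Prop :=
  (forall t : R, 0 <= t -> x u @[u --> t^'+] --> x t) /\
  (forall t : R, 0 < t -> cvg (x u @[u --> t^'-])).

(* x_{t-}, with the convention x_{0-} = x_0 *)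
Definition left_limit x (t : R) : R :=
  if 0 < t then lim (x u @[u --> t^'-]) else x t.

Definition jump_set x : set (R * R) :=
  [set tx | 0 <= tx.1 /\
    ((left_limit x tx.1 < tx.2 /\ tx.2 < x tx.1) \/
     (x tx.1 < tx.2 /\ tx.2 < left_limit x tx.1))].

(* The product sigma-algebra on R^[0, +oo), generated by the evaluations at
   nonnegative times. *)
Definition path_cylinders : set (set (R -> R)) :=
  [set C | exists (t : R) (B : set R),
    [/\ 0 <= t, measurable B & C = [set x | B (x t)]]].

Definition path_sigma : set (set (R -> R)) := <<s path_cylinders >>.

End paths.

Section processes.
Context {R : realType} {d : measure_display} {T : measurableType d}
  {P : probability T R}.
Implicit Types X Y Z : R -> {RV P >-> R}.

Definition sample_path X (w : T) : R -> R := fun t => X t w.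

Definition cadlag X : Prop := forall w, cadlag_path (sample_path X w).

Definition continuous_in_probability X : Prop :=
  forall t : R, 0 <= t -> forall e : R, 0 < e ->
    P [set w | e <= `|X u w - X t w|]
      @[u --> within [set u : R | 0 <= u] (nbhs t)] --> (0 : \bar R)%E.

Definition independent_processes Y Z : Prop :=
  forall A B, path_sigma A -> path_sigma B ->
    P (sample_path Y @^-1` A `&` sample_path Z @^-1` B) =
    (P (sample_path Y @^-1` A) * P (sample_path Z @^-1` B))%E.

(* The smallest closed set of full measure for the law of V. *)
Definition Supp (V : {RV P >-> R}) : set R :=
  \bigcap_(C in [set C | closed C /\ P (V @^-1` C) = 1%E]) C.

Definition MSupp X : set (R * R) :=
  [set tx | 0 <= tx.1 /\ Supp (X tx.1) tx.2].

Definition filtration (F : R -> set (set T)) : Prop :=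
  [/\ forall t : R, 0 <= t -> sigma_algebra setT (F t),
      forall t : R, 0 <= t -> F t `<=` measurable &
      forall s t : R, 0 <= s -> s <= t -> F s `<=` F t].

Definition measurable_wrt (G : set (set T)) (V : T -> R) : Prop :=
  forall B : set R, measurable B -> G (V @^-1` B).

(* W is a version of the conditional expectation E[V | G]. *)
Definition is_cond_exp (G : set (set T)) (V W : {RV P >-> R}) : Prop :=
  [/\ measurable_wrt G W,
      P.-integrable setT (EFin \o W) &
      forall A, G A -> (\int[P]_(w in A) (W w)%:E = \int[P]_(w in A) (V w)%:E)%E].

Definition martingale (F : R -> set (set T)) X : Prop :=
  [/\ forall t : R, 0 <= t -> measurable_wrt (F t) (X t),
      forall t : R, 0 <= t -> P.-integrable setT (EFin \o X t) &
      forall s t : R, 0 <= s -> s <= t -> is_cond_exp (F s) (X t) (X s)].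

End processes.

(* The two processes may live on different probability spaces. *)
Definition same_distribution {R : realType}
    {d1 d2 : measure_display} {T1 : measurableType d1} {T2 : measurableType d2}
    {P1 : probability T1 R} {P2 : probability T2 R}
    (X : R -> {RV P1 >-> R}) (Y : R -> {RV P2 >-> R}) : Prop :=
  forall A, path_sigma A -> P1 (sample_path X @^-1` A) = P2 (sample_path Y @^-1` A).

(* The event below involves uncountably many times and need not belong to the
   given sigma-algebra: "probability zero" means being contained in a
   measurable null set. *)
Definition almost_continuous {R : realType} {d : measure_display}
    {T : measurableType d} {P : probability T R}
    (X : R -> {RV P >-> R}) : Prop :=
  [/\ cadlag X, continuous_in_probability X &
    forall (d' : measure_display) (T' : measurableType d')
      (P' : probability T' R) (Y Z : R -> {RV P' >-> R}),
      cadlag Y -> cadlag Z -> independent_processes Y Z ->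
      same_distribution Y X -> same_distribution Z X ->
      forall s t : R, 0 <= s -> s < t ->
        P'.-negligible [set w | [/\ Y s w < Z s w, Y t w > Z t w &
          forall u : R, s < u -> u < t -> Y u w <> Z u w]]].

(* Main.v *)
(** Necessity: on the product space take two independent copies of [X]. If the
    first jumps at [t] across a point of the support of [X t], the second is
    with positive conditional probability at [t] inside the jump interval and
    continuous there, so the copies exchange their order across [t] without
    meeting; rational times reduce this to countably many null events.

    Sufficiency: let [D] be the difference of two independent copies and [sigma]
    the first time at which its running infimum reaches [0], from [D s > 0].
    Exchanging order without meeting forces [D sigma <> 0], and this has
    probability zero. If [D] jumps across [0], one copy jumps over the other,
    which is in the support of its own marginal since the two do not jump
    together. If [D] descends to [0] and jumps up from there, the level it jumps
    over is not charged, while copies with slightly earlier such jumps would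
    force it to be (see [touching_negligible]). So [D sigma <= 0]. Stopping the
    martingale [D] when it goes below [c > 0] and letting [c] tend to [0] shows
    that [D t] has nonnegative integral over the event that [sigma] occurs;
    stopping at [sigma] then gives [D sigma = 0]. *)
Require Import Defs.
From HB Require Import structures.
From mathcomp Require Import all_boot all_order all_algebra.
From mathcomp Require Import all_classical all_reals all_analysis.
From mathcomp Require Import measurable_realfun ring lra.
Import Order.TTheory GRing.Theory Num.Theory.
Import numFieldNormedType.Exports.
Local Open Scope classical_set_scope.
Local Open Scope ring_scope.

Set Implicit Arguments.
Unset Strict Implicit.
Unset Printing Implicit Defensive.

(** * One-sided limits in epsilon-delta form *)

Section one_sided_limits.
Context {R : realType}.
Implicit Types (x y : R -> R) (s t u v l : R).

Definition right_cont x t := forall e : R, 0 < e ->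
  exists2 d : R, 0 < d & forall u, t <= u < t + d -> `|x u - x t| < e.

Definition has_llim x t l := forall e : R, 0 < e ->
  exists2 d : R, 0 < d & forall u, t - d < u < t -> `|x u - l| < e.

(** A form of [cadlag_path] with the left limit left existential, so that it passes directly to
    differences of paths. *)
Definition rcll x := (forall t, 0 <= t -> right_cont x t) /\
  (forall t, 0 < t -> exists l, has_llim x t l).

Lemma right_contB x y t :
  right_cont x t -> right_cont y t -> right_cont (fun u => x u - y u) t.
Proof.
move=> xt yt e e0; have e2 : 0 < e / 2 by lra.
have [d1 d10 H1] := xt _ e2; have [d2 d20 H2] := yt _ e2.
exists (Num.min d1 d2); first by rewrite lt_min d10.
move=> u /andP[tu ut].
have /H1 h1 : t <= u < t + d1.
  by rewrite tu/= (lt_le_trans ut)// lerD2l ge_min lexx.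
have /H2 h2 : t <= u < t + d2.
  by rewrite tu/= (lt_le_trans ut)// lerD2l ge_min lexx orbT.
have -> : x u - y u - (x t - y t) = (x u - x t) - (y u - y t) by lra.
by rewrite (le_lt_trans (ler_normB _ _))//; lra.
Qed.

Lemma has_llimB x y t l m :
  has_llim x t l -> has_llim y t m -> has_llim (fun u => x u - y u) t (l - m).
Proof.
move=> xt yt e e0; have e2 : 0 < e / 2 by lra.
have [d1 d10 H1] := xt _ e2; have [d2 d20 H2] := yt _ e2.
exists (Num.min d1 d2); first by rewrite lt_min d10.
move=> u /andP[tu ut].
have /H1 h1 : t - d1 < u < t.
  by rewrite ut andbT (le_lt_trans _ tu)// lerD2l lerN2 ge_min lexx.
have /H2 h2 : t - d2 < u < t.
  by rewrite ut andbT (le_lt_trans _ tu)// lerD2l lerN2 ge_min lexx orbT.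
have -> : x u - y u - (l - m) = (x u - l) - (y u - m) by lra.
by rewrite (le_lt_trans (ler_normB _ _))//; lra.
Qed.

Lemma rcllB x y : rcll x -> rcll y -> rcll (fun u => x u - y u).
Proof.
move=> [xr xl] [yr yl]; split=> t t0.
  by apply: right_contB; [exact: xr|exact: yr].
have [l xtl] := xl t t0; have [m ytm] := yl t t0.
by exists (l - m); exact: has_llimB.
Qed.

Lemma has_llim_uniq x t l m : has_llim x t l -> has_llim x t m -> l = m.
Proof.
move=> xl xm; apply/eqP; rewrite -subr_eq0 -normr_eq0; apply/eqP.
apply/le_anti; rewrite normr_ge0 andbT; apply/ler_addgt0Pr => e e0.
rewrite add0r.
have e2 : 0 < e / 2 by lra.
have [d1 d10 H1] := xl _ e2; have [d2 d20 H2] := xm _ e2.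
pose d := Num.min d1 d2.
have d0 : 0 < d by rewrite lt_min d10.
have dd1 : d <= d1 by rewrite ge_min lexx.
have dd2 : d <= d2 by rewrite ge_min lexx orbT.
have /H1 h1 : t - d1 < t - d / 2 < t by apply/andP; split; lra.
have /H2 h2 : t - d2 < t - d / 2 < t by apply/andP; split; lra.
have -> : l - m = (x (t - d / 2) - m) - (x (t - d / 2) - l) by lra.
by rewrite (le_trans (ler_normB _ _))//; lra.
Qed.

Lemma cadlag_llim x t : cadlag_path x -> 0 < t ->
  has_llim x t (left_limit x t).
Proof.
move=> [_ xl] t0 e e0; rewrite /left_limit t0.
have /cvgrPdist_lt/(_ e e0) := xl t t0.
case=> d /= d0 H; exists d => // u /andP[du ut].
by rewrite distrC; apply: H => //=; rewrite gtr0_norm; lra.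
Qed.

Lemma cadlag_rcll x : cadlag_path x -> rcll x.
Proof.
move=> cx; split=> t t0; last first.
  by exists (left_limit x t); exact: cadlag_llim.
move=> e e0; have /cvgrPdist_lt/(_ e e0) := cx.1 t t0.
case=> d /= d0 H; exists d => // u /andP[].
rewrite le_eqVlt => /predU1P[<- _|tu ut]; first by rewrite subrr normr0.
by rewrite distrC; apply: H => //=; rewrite ltr0_norm; lra.
Qed.

Lemma right_cont_gt x t c : right_cont x t -> c < x t ->
  exists2 d : R, 0 < d & forall u, t <= u < t + d -> c < x u.
Proof.
move=> xt ct; have [|d d0 H] := xt (x t - c); first by lra.
by exists d => // u /H; rewrite ltr_norml => /andP[]; lra.
Qed.

Lemma right_cont_lt x t c : right_cont x t -> x t < c ->
  exists2 d : R, 0 < d & forall u, t <= u < t + d -> x u < c.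
Proof.
move=> xt ct; have [|d d0 H] := xt (c - x t); first by lra.
by exists d => // u /H; rewrite ltr_norml => /andP[]; lra.
Qed.

Lemma has_llim_gt x t l c : has_llim x t l -> c < l ->
  exists2 d : R, 0 < d & forall u, t - d < u < t -> c < x u.
Proof.
move=> xt ct; have [|d d0 H] := xt (l - c); first by lra.
by exists d => // u /H; rewrite ltr_norml => /andP[]; lra.
Qed.

Lemma has_llim_lt x t l c : has_llim x t l -> l < c ->
  exists2 d : R, 0 < d & forall u, t - d < u < t -> x u < c.
Proof.
move=> xt ct; have [|d d0 H] := xt (c - l); first by lra.
by exists d => // u /H; rewrite ltr_norml => /andP[]; lra.
Qed.

Lemma left_point s v d : s < v -> 0 < d -> exists u, [/\ s < u, u < v & v - d < u].
Proof.
move=> sv d0; have m1 : Num.max s (v - d) < v by rewrite gt_max sv/=; lra.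
have m2 : s <= Num.max s (v - d) by rewrite le_max lexx.
have m3 : v - d <= Num.max s (v - d) by rewrite le_max lexx orbT.
by exists ((Num.max s (v - d) + v) / 2); split; lra.
Qed.

End one_sided_limits.

(** * First passage of the running infimum *)

Section first_passage.
Context {R : realType}.
Implicit Types (x : R -> R) (s t u v : R).

(** Rational fractions of the interval rather than rational times: [r = 1] gives the end point [u],
    which right-continuity cannot reach from inside [[s, u]]. *)
Definition rat_time s u (r : rat) : R := s + (u - s) * ratr r.

(* For right-continuous [x], the infimum over [s, u] is at most [0]; rational
   times make this an event. *)
Definition hits s u x := 0 < x s /\ forall k : nat,
  exists2 r : rat, 0 <= r <= 1 & x (rat_time s u r) < k.+1%:R^-1.

(** The approximation of [hits] from a level [c > 0]; [dips_near_hits] lets [c] tend to 0. *)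
Definition dips s u (c : R) x := c <= x s /\
  exists2 r : rat, 0 <= r <= 1 & x (rat_time s u r) < c.

Lemma rat_time_itv s u (r : rat) : s <= u -> 0 <= r <= 1 ->
  s <= rat_time s u r <= u.
Proof.
move=> su /andP[r0 r1]; rewrite /rat_time.
have r0' : 0 <= ratr r :> R by rewrite ler0q.
have r1' : ratr r <= 1 :> R by rewrite -[leRHS](rmorph1 (@ratr R)) ler_rat.
by apply/andP; split; nra.
Qed.

Lemma rat_time_dense x s u v c : s <= v <= u -> right_cont x v -> x v < c ->
  exists2 r : rat, 0 <= r <= 1 & x (rat_time s u r) < c.
Proof.
move=> /andP[sv]; rewrite le_eqVlt => /predU1P[->|vu] xv xvc.
  exists 1; rewrite ?ler01 ?lexx// /rat_time rmorph1 mulr1.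
  by have -> : s + (u - s) = u by lra.
have su : 0 < u - s by lra.
have [d d0 H] := right_cont_lt xv xvc.
have [r] : exists r : rat,
    ratr r \in `](v - s) / (u - s), (Num.min u (v + d) - s) / (u - s)[.
  apply: rat_in_itvoo; rewrite ltr_pM2r ?invr_gt0// ltrD2r lt_min vu/=; lra.
rewrite in_itv/= ltr_pdivrMr// ltr_pdivlMr// => /andP[r1 r2].
have m1 : Num.min u (v + d) <= u by rewrite ge_min lexx.
have m2 : Num.min u (v + d) <= v + d by rewrite ge_min lexx orbT.
exists r; last by apply: H; rewrite /rat_time mulrC; apply/andP; split; lra.
rewrite -(ler0q R) -(ler_rat R) rmorph1; apply/andP; split.
  by rewrite -(pmulr_lge0 _ su); lra.
by rewrite -(ler_pM2r su) mul1r; lra.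
Qed.

Lemma hitsP x s u : 0 <= s <= u -> rcll x ->
  hits s u x <->
  0 < x s /\ forall c, 0 < c -> exists2 v, s <= v <= u & x v < c.
Proof.
move=> /andP[s0 su] [xr _]; split=> -[xs H]; split=> //.
  move=> c c0; have [k kc] : exists k : nat, k.+1%:R^-1 < c.
    have ic : 0 <= c^-1 by rewrite invr_ge0 ltW.
    exists (Num.bound c^-1); rewrite invf_plt ?posrE ?ltr0n//.
    by rewrite (lt_le_trans (archi_boundP ic))// ler_nat.
  have [r r01 xr1] := H k; exists (rat_time s u r).
    exact: rat_time_itv.
  exact: lt_trans kc.
move=> k; have [|v svu xv] := H k.+1%:R^-1; first by rewrite invr_gt0 ltr0n.
apply: rat_time_dense xv => //; apply: xr.
by case/andP: svu => + _; exact: le_trans.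
Qed.

Lemma dipsP x s u c : 0 <= s <= u -> rcll x ->
  dips s u c x <-> c <= x s /\ exists2 v, s <= v <= u & x v < c.
Proof.
move=> /andP[s0 su] [xr _]; split=> -[xs].
  case=> r r01 xr1; split=> //; exists (rat_time s u r) => //.
  exact: rat_time_itv.
case=> v svu xv; split=> //; apply: rat_time_dense xv => //; apply: xr.
by case/andP: svu => + _; exact: le_trans.
Qed.

(** The running infimum from [s] first reaches 0 at [v]. The last clause records how: by a
    nonpositive value, or by approach from the left with limit 0. *)
Definition first_passage s t x v := [/\ s < v <= t,
  forall u, s <= u < v -> ~ hits s u x,
  forall u, v <= u <= t -> hits s u x,
  forall u, s <= u < v -> exists2 c, 0 < c & forall w, s <= w <= u -> c <= x w &
  x v <= 0 \/ has_llim x v 0].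

(** Take the infimum [v] of the times by which [x] has been below every [c > 0]. Right-continuity at
    [s] gives [s < v], and the alternative [xv] shows that the infimum is attained. *)
Lemma first_passage_ex x s t : 0 <= s < t -> rcll x -> hits s t x ->
  exists v, first_passage s t x v.
Proof.
move=> /andP[s0 st] cx hst.
have xs : 0 < x s by case: hst.
pose A := [set u | s <= u <= t /\
  forall c, 0 < c -> exists2 v, s <= v <= u & x v < c].
have hA u : s <= u <= t -> hits s u x <-> A u.
  move=> /andP[su ut]; rewrite hitsP// ?s0//; split=> [[_ h]|[_ h]]; split=> //.
  by rewrite su.
have At : A t by apply/hA => //; rewrite lexx ltW.
have lA : has_lbound A by exists s => u [/andP[]].
have iA : has_inf A by split; [exists t|].
pose v := inf A.
have vle u : A u -> v <= u by move=> Au; exact: ge_inf.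
have vt : v <= t by exact: vle.
have ltv u : s <= u < v -> ~ A u.
  by move=> /andP[_ uv] /vle; rewrite leNgt uv.
have pos u : s <= u < v ->
    exists2 c, 0 < c & forall w, s <= w <= u -> c <= x w.
  move=> suv; apply: contrapT => Nc; apply: (ltv u) => //; split.
    by case/andP: suv => -> /ltW/le_trans->.
  move=> c c0; apply: contrapT => Nv; apply: Nc; exists c => // w sw.
  by rewrite leNgt; apply/negP => xw; apply: Nv; exists w.
have sv : s < v.
  have [|d d0 H] := right_cont_gt (c := x s / 2) (cx.1 s s0).
    lra.
  apply: (@lt_le_trans _ _ (Num.min t (s + d))).
    by rewrite lt_min st ltrDl.
  apply: lb_le_inf; first by exists t.
  move=> u [/andP[su ut] Au]; rewrite ge_min; apply/orP; right.
  rewrite leNgt; apply/negP => usd.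
  have [|w /andP[sw wu]] := Au (x s / 2); first by lra.
  by rewrite ltNge ltW//; apply: H; rewrite sw/=; lra.
have v0 : 0 < v by lra.
(* Positive lower bounds on every [[s, u]] with [u < v] give [l >= 0]. If [l] and [x v] were both
   positive, [x] would stay above a positive constant up to [v + e], against [v = inf A]. *)
have xv : x v <= 0 \/ has_llim x v 0.
  have [l xl] := cx.2 v v0.
  have [|xv0] := leP (x v) 0; [by left|right].
  have l0 : 0 <= l.
    rewrite leNgt; apply/negP => l0.
    have [d d0 H] := has_llim_lt xl l0.
    have [u [su uv du]] := left_point sv d0.
    have [|c c0 posu] := pos u; first by rewrite uv ltW.
    have := H u; rewrite uv du => /(_ isT).
    by have := posu u; rewrite (ltW su) lexx => /(_ isT); lra.
  have [l_eq|l_neq] := eqVneq l 0; [by rewrite -l_eq|exfalso].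
  have {l0 l_neq}lgt : 0 < l by rewrite lt_neqAle eq_sym l_neq.
  have [|d d0 H] := has_llim_gt (c := l / 2) xl; first lra.
  have [|e e0 K] := right_cont_gt (c := x v / 2) (cx.1 v (ltW v0)); first lra.
  have [u [su uv du]] := left_point sv d0.
  have [|c c0 posu] := pos u; first by rewrite uv ltW.
  have [a Aa av] : exists2 a, A a & a < v + e by apply: inf_adherent.
  have mc : 0 < Num.min c (Num.min (l / 2) (x v / 2)).
    by rewrite !lt_min c0/=; apply/andP; split; lra.
  have [sat /(_ _ mc)[w /andP[sw wa]]] := Aa.
  rewrite !lt_min => /and3P[w1 w2 w3].
  have [wu|uw] := leP w u.
    by have := posu w; rewrite sw wu => /(_ isT); lra.
  have [wv|vw] := ltP w v.
    by have := H w; rewrite wv (lt_trans du uw) => /(_ isT); lra.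
  by have := K w; rewrite vw (le_lt_trans wa av) => /(_ isT); lra.
have Av : A v.
  split=> [|c c0]; first by rewrite vt ltW.
  case: xv => [xv|xv].
    by exists v; rewrite ?lexx ?(ltW sv)//; lra.
  have [d d0 H] := has_llim_lt xv c0.
  have [u [su uv du]] := left_point sv d0.
  by exists u; [rewrite !ltW|apply: H; rewrite du].
exists v; split=> //.
- by rewrite sv.
- move=> u /andP[su uv]; rewrite hA; first by apply: ltv; rewrite su.
  by rewrite su (le_trans (ltW uv)).
- move=> u /andP[vu ut]; apply/hA; first by rewrite ut (le_trans _ vu)// ltW.
  split; first by rewrite ut (le_trans _ vu)// ltW.
  move=> c /Av.2[w /andP[sw wv] xw]; exists w => //.
  by rewrite sw (le_trans wv).
Qed.

(** The infimum need not be attained: [x v = c] can be followed at once by values below [c]. So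
    [dips] is asserted only strictly after [v], and [v = s] is allowed. *)
Lemma dips_time x s t c : 0 <= s < t -> rcll x -> dips s t c x ->
  exists v, [/\ s <= v <= t, forall u, s <= u < v -> ~ dips s u c x,
    forall u, v < u <= t -> dips s u c x &
    forall u, s <= u < v -> c <= x u].
Proof.
move=> /andP[s0 st] cx dst.
have xs : c <= x s by case: dst.
pose A := [set u | s <= u <= t /\ exists2 v, s <= v <= u & x v < c].
have hA u : s <= u <= t -> dips s u c x <-> A u.
  move=> /andP[su ut]; rewrite dipsP// ?s0//; split=> [[_ h]|[_ h]]; split=> //.
  by rewrite su.
have At : A t by apply/hA => //; rewrite lexx ltW.
have lA : has_lbound A by exists s => u [/andP[]].
have iA : has_inf A by split; [exists t|].
pose v := inf A.
have vle u : A u -> v <= u by move=> Au; exact: ge_inf.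
have vt : v <= t by exact: vle.
have sv : s <= v by apply: lb_le_inf; [exists t|move=> u [/andP[]]].
have ltv u : s <= u < v -> ~ A u.
  by move=> /andP[_ uv] /vle; rewrite leNgt uv.
exists v; split=> //.
- by rewrite sv.
- move=> u /andP[su uv]; rewrite hA; first by apply: ltv; rewrite su.
  by rewrite su (le_trans (ltW uv)).
- move=> u /andP[vu ut].
  have [a [/andP[sa at'] [w /andP[sw wa] xw]] au] : exists2 a, A a & a < u.
    have -> : u = v + (u - v) by lra.
    by apply: inf_adherent => //; lra.
  apply/hA; first by rewrite ut andbT; lra.
  split; first by rewrite ut andbT; lra.
  by exists w => //; rewrite sw/=; lra.
- move=> u /andP[su uv]; rewrite leNgt; apply/negP => xu.
  apply: (ltv u); first by rewrite su.
  split; first by rewrite su (le_trans (ltW uv)).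
  by exists u => //; rewrite su lexx.
Qed.

End first_passage.

(** * Negligible sets *)

Section negligible_complements.
Context d (T : measurableType d) (R : realType).
Variable mu : {measure set T -> \bar R}.

Lemma measurable_pred (b : T -> bool) :
  measurable_fun setT b -> measurable [set w | b w].
Proof. by move=> mb; have := mb measurableT [set true] I; rewrite setTI. Qed.

Lemma negligible_countable (I : countType) (F : I -> set T) :
  (forall i, mu.-negligible (F i)) -> mu.-negligible [set w | exists i, F i w].
Proof.
move=> nF; pose G n := if unpickle n is Some i then F i else set0.
apply: (@negligibleS _ _ _ _ (\bigcup_n G n)).
  by move=> w [i Fi]; exists (pickle i) => //; rewrite /G pickleK.
apply: negligible_bigcup => n; rewrite /G; case: unpickle => //.
exact: negligible_set0.
Qed.

Lemma negligible_small (A : set T) : (forall e : R, 0 < e ->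
    exists B, [/\ measurable B, A `<=` B & (mu B < e%:E)%E]) ->
  mu.-negligible A.
Proof.
move=> H; have H' n : exists B,
    [/\ measurable B, A `<=` B & (mu B < (n.+1%:R^-1)%:E)%E].
  by apply: H; rewrite invr_gt0 ltr0n.
pose B n := projT1 (cid (H' n)).
have BP n : [/\ measurable (B n), A `<=` B n & (mu (B n) < (n.+1%:R^-1)%:E)%E].
  by rewrite /B; case: cid.
exists (\bigcap_n B n); split.
- by apply: bigcapT_measurable => n; case: (BP n).
- apply/eqP; rewrite -measure_le0; apply/lee_addgt0Pr => e e0; rewrite add0e.
  have ie : 0 <= e^-1 by rewrite invr_ge0 ltW.
  pose n := Num.bound e^-1; case: (BP n) => mB _ Bn.
  apply: (@le_trans _ _ (mu (B n))).
    apply: le_measure; rewrite ?inE//; last exact: bigcap_inf.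
    by apply: bigcapT_measurable => k; case: (BP k).
  apply/ltW/(lt_le_trans Bn); rewrite lee_fin.
  rewrite invf_ple ?posrE ?ltr0n//.
  by rewrite ltW// (lt_le_trans (archi_boundP ie))// ler_nat.
- by move=> w Aw n _; case: (BP n) => _ + _; exact.
Qed.

End negligible_complements.

(** * Null sets of a product and their sections *)

Section null_sections.
Context d1 d2 (T1 : measurableType d1) (T2 : measurableType d2) (R : realType).
Variables (P1 : probability T1 R) (P2 : probability T2 R).
Local Open Scope ereal_scope.

Lemma null_xsection (M : set (T1 * T2)) : measurable M ->
  P1.-negligible [set x | ~ P2.-negligible (xsection M x)] -> (P1 \x P2) M = 0.
Proof.
move=> mM nM; rewrite /product_measure1.
rewrite (@ae_eq_integral _ _ _ P1 setT (cst 0)) ?integral0//.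
  exact: measurable_fun_xsection.
apply: negligibleS nM => x /= /not_implyP[_ H] H'; apply: H.
by apply: measure_negligible => //; exact: measurable_xsection.
Qed.

Lemma null_ysection (M : set (T1 * T2)) : measurable M ->
  P2.-negligible [set y | ~ P1.-negligible (ysection M y)] -> (P1 \x P2) M = 0.
Proof.
(* Uniqueness of the product measure exchanges the order of the iterated integral. *)
move=> mM nM; rewrite (product_measure_unique (m' := (P1 \x^ P2)))//; last first.
  by move=> A B mA mB; exact: product_measure2E.
change (\int[P2]_y (P1 \o ysection M) y = 0).
rewrite (@ae_eq_integral _ _ _ P2 setT (cst 0)) ?integral0//.
  exact: measurable_fun_ysection.
apply: negligibleS nM => x /= /not_implyP[_ H] H'; apply: H.
by apply: measure_negligible => //; exact: measurable_ysection.
Qed.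

Lemma null_xsection_ae (M : set (T1 * T2)) : measurable M ->
  (P1 \x P2) M = 0 -> P1.-negligible [set x | P2 (xsection M x) != 0].
Proof.
move=> mM M0.
have mf := measurable_fun_xsection P2 mM.
have /(ae_eq_integral_abs P1 measurableT mf) :
    \int[P1]_x `|(P2 \o xsection M) x| = 0.
  by rewrite -[RHS]M0; apply: eq_integral => x _; rewrite gee0_abs.
by apply: negligibleS => x /= /eqP Hx H; apply: Hx; exact: H.
Qed.

End null_sections.

(** * No jumps at fixed times *)

Section fixed_jumps.
Context {R : realType} {d : measure_display} {T : measurableType d}
  {P : probability T R}.
Variable X : R -> {RV P >-> R}.
Hypothesis X_cadlag : cadlag X.
Hypothesis X_cip : continuous_in_probability X.

Definition jumps (x : R -> R) (t : R) := left_limit x t <> x t.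

(** A jump at [t] keeps [X u] at a fixed distance from [X t] for all [u] shortly before [t], which
    continuity in probability makes arbitrarily improbable. *)
Lemma no_fixed_jump (t : R) : 0 < t ->
  P.-negligible [set w | jumps (sample_path X w) t].
Proof.
move=> t0.
pose F (kn : nat * nat) := [set w | forall u : R,
  t - kn.2.+1%:R^-1 < u < t -> kn.1.+1%:R^-1 <= `|X u w - X t w|].
apply: (@negligibleS _ _ _ _ [set w | exists kn, F kn w]).
  move=> w /eqP; rewrite -subr_eq0 -normr_gt0; set l := left_limit _ _ => lt.
  have xl := cadlag_llim (X_cadlag w) t0.
  have l4 : 0 < `|l - sample_path X w t| / 2 by lra.
  have [k kl] := ltr_add_invr l4.
  rewrite add0r in kl.
  have [e e0 H] := xl _ l4; have [n ne] := ltr_add_invr e0.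
  rewrite add0r in ne.
  exists (k, n) => u /= /andP[nu ut].
  have /H h : t - e < u < t by rewrite ut andbT (lt_trans _ nu)// ltrD2l ltrN2.
  have := ler_distD (sample_path X w u) l (sample_path X w t).
  rewrite [X in _ <= X + _]distrC -/(sample_path X w u) -/(sample_path X w t).
  move: k.+1%:R^-1 kl h => i; rewrite -/l; lra.
apply: negligible_countable => -[k n]; apply: negligible_small => e e0.
have k0 : 0 < k.+1%:R^-1 :> R by rewrite invr_gt0 ltr0n.
have n0 : 0 < n.+1%:R^-1 :> R by rewrite invr_gt0 ltr0n.
have /fine_cvgP[[d1 /= d10 H1] /cvgrPdist_lt/(_ e e0)[d2 /= d20 H2]] :=
  X_cip (ltW t0) k0.
(* The time [u] must lie in the window of [F], be nonnegative, have a finite probability ([d1]) and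
   have one below [e] ([d2]). *)
pose m := Num.min n.+1%:R^-1 (Num.min t (Num.min d1 d2)).
have m0 : 0 < m by rewrite !lt_min n0 t0 d10.
have [mn [mt [m1 m2]]] : m <= n.+1%:R^-1 /\ m <= t /\ m <= d1 /\ m <= d2.
  by rewrite /m !ge_min !lexx ?orbT.
pose u := t - m / 2.
exists [set w | k.+1%:R^-1 <= `|X u w - X t w|]; split.
- apply: measurable_pred; apply: measurable_fun_ler => //.
  by apply: measurableT_comp => //; exact: measurable_funB.
- by move=> w /(_ u); apply; rewrite /= /u; move: mn;
  move: (n.+1%:R^-1) => i mi; apply/andP; split; lra.
- have u0 : 0 <= u by rewrite /u; lra.
  have d1u : ball t d1 u by rewrite /ball/= /u gtr0_norm; lra.
  have d2u : ball t d2 u by rewrite /ball/= /u gtr0_norm; lra.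
  rewrite -[ltLHS]fineK; last exact: H1.
  rewrite lte_fin; have := H2 u d2u u0.
  by rewrite sub0r normrN; exact/le_lt_trans/ler_norm.
Qed.

End fixed_jumps.

(** * Supports and open intervals *)

Section supports.
Context {R : realType} {d : measure_display} {T : measurableType d}
  {P : probability T R}.

Lemma measurable_itvoo (V : {RV P >-> R}) (a b : R) :
  measurable [set w | a < V w < b].
Proof.
by apply: measurable_pred; apply: measurable_and; exact: measurable_fun_ltr.
Qed.

(** Otherwise the complement of the interval would be a closed set of full measure missing [x]. *)
Lemma Supp_itvoo_gt0 (V : {RV P >-> R}) (a x b : R) :
  Supp V x -> a < x < b -> P [set w | a < V w < b] <> 0%E.
Proof.
move=> Vx axb V0; pose C := ~` `]a, b[%classic.
suff: C x by apply; rewrite /= in_itv.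
apply: Vx; split; first exact/open_closedC/itv_open.
have -> : V @^-1` C = ~` [set w | a < V w < b].
  by apply/seteqP; split=> w; rewrite /C /= in_itv.
by rewrite probability_setC ?V0 ?sube0//; exact: measurable_itvoo.
Qed.

(** Every point outside the support has a null neighbourhood with rational end points, and there are
    countably many of these. *)
Lemma Supp_itvoo_eq0 (V : {RV P >-> R}) (a b : R) :
  (forall x, a < x < b -> ~ Supp V x) -> P [set w | a < V w < b] = 0%E.
Proof.
move=> H; apply: measure_negligible; first exact: measurable_itvoo.
pose F (pq : rat * rat) := if P [set w | ratr pq.1 < V w < ratr pq.2] == 0%E
  then [set w | ratr pq.1 < V w < ratr pq.2] else set0.
apply: (@negligibleS _ _ _ _ [set w | exists pq, F pq w]); last first.
  apply: negligible_countable => pq; rewrite /F.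
  case: ifPn => [/eqP V0|_]; last exact: negligible_set0.
  by apply/negligibleP => //; exact: measurable_itvoo.
move=> w /= /H; rewrite /Supp /= => /existsNP[C] /not_implyP[[cC PC] VC].
have : nbhs (V w) (~` C) by apply: open_nbhs_nbhs; split => //; exact: closed_openC.
move=> /nbhs_ballP[e /= e0 He].
have [p] := @rat_in_itvoo R (V w - e) (V w) ltac:(lra).
rewrite in_itv/= => /andP[p1 p2].
have [q] := @rat_in_itvoo R (V w) (V w + e) ltac:(lra).
rewrite in_itv/= => /andP[q1 q2].
exists (p, q); rewrite /F /= ifT; first exact/andP.
have mC : measurable (V @^-1` C) by apply: measurable_funPTI; exact: closed_measurable.
have PC0 : P (~` (V @^-1` C)) = 0%E by rewrite probability_setC// PC subee.
rewrite -measure_le0 -PC0.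
apply: le_measure; rewrite ?inE.
- exact: measurable_itvoo.
- exact: measurableC.
- move=> w' /= /andP[pw wq]; apply: He => /=; rewrite /ball/= ltr_norml.
  by apply/andP; split; lra.
Qed.

End supports.

Definition strictly_between {R : realType} (a b c : R) :=
  (a < c < b) || (b < c < a).

(** * Jumps of a fixed path against a random one *)

Section jumps_avoiding_the_support.
Context {R : realType} {d : measure_display} {T : measurableType d}
  {P : probability T R}.
Variable X : R -> {RV P >-> R}.
Hypothesis X_cadlag : cadlag X.
Hypothesis X_cip : continuous_in_probability X.

(** The form in which disjointness from the support is used: the law of [X t] does not charge the
    jump interval of [x]. At continuity times of [x] that interval is empty. *)
Definition avoiding (x : R -> R) := forall t : R, 0 < t ->
  P.-negligible [set w | strictly_between (left_limit x t) (x t) (X t w)].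

Lemma jump_set_avoiding x :
  jump_set x `&` MSupp X = set0 -> avoiding x.
Proof.
move=> x0 t t0.
apply: (@negligibleS _ _ _ _ ([set w | left_limit x t < X t w < x t] `|`
  [set w | x t < X t w < left_limit x t])).
  by move=> w /orP.
have H y : strictly_between (left_limit x t) (x t) y -> ~ Supp (X t) y.
  move=> xy Xy; suff : set0 (t, y) by [].
  rewrite -x0; split; split=> /=; rewrite ?ltW//.
  by case/orP: xy => /andP[]; [left|right].
apply: negligibleU; apply/negligibleP => //.
- exact: measurable_itvoo.
- by apply: Supp_itvoo_eq0 => y xy; apply: H; apply/orP; left.
- exact: measurable_itvoo.
- by apply: Supp_itvoo_eq0 => y xy; apply: H; apply/orP; right.
Qed.

(* The jumps of [x] are labelled by a sign [b] and two rationals: a jump over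
   level [q] is the first passage over [q] after time [r]. *)
Lemma common_jump_negligible x : cadlag_path x -> avoiding x ->
  P.-negligible [set w | exists t : R, [/\ 0 < t, jumps x t &
    jumps (sample_path X w) t \/
    strictly_between (left_limit x t) (x t) (X t w)]].
Proof.
move=> cx ax.
(* The sign turns every jump into an upward one: [b] is true for downward jumps. *)
pose lab (brq : bool * rat * rat) t := [/\ ratr brq.1.2 < t,
  forall u : R, ratr brq.1.2 < u < t -> (-1) ^+ brq.1.1 * x u < ratr brq.2 &
  ratr brq.2 < (-1) ^+ brq.1.1 * x t].
have lab_uniq i (t u : R) : lab i t -> lab i u -> t = u.
  move=> [rt xt qt] [ru xu qu]; have [tu|ut|//] := ltgtP t u.
  - by have := xu t; rewrite rt tu => /(_ isT); rewrite ltNge ltW.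
  - by have := xt u; rewrite ru ut => /(_ isT); rewrite ltNge ltW.
have lab_ex (t : R) : 0 < t -> jumps x t -> exists i, lab i t.
  move=> t0 jt; have xl := cadlag_llim cx t0; set l := left_limit x t in xl jt.
  pose b := x t < l.
  have [q] : exists q : rat, ratr q \in `]((-1) ^+ b * l), ((-1) ^+ b * x t)[.
    apply: rat_in_itvoo; rewrite /b; have [tl|tl|tl] := ltgtP (x t) l.
    - by rewrite /= expr1 !mulN1r ltrN2.
    - by rewrite /= expr0 !mul1r.
    - by exfalso; apply: jt.
  rewrite in_itv/=.
  move=> /andP[lq qt].
  have [e e0 H] : exists2 e : R, 0 < e & forall u : R, t - e < u < t ->
      (-1) ^+ b * x u < ratr q.
    move: lq; case: b {qt}; rewrite ?expr0 ?expr1 => lq.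
      have [|e e0 H] := has_llim_gt (c := - ratr q) xl; first lra.
      by exists e => // u /H; lra.
    have [|e e0 H] := has_llim_lt (c := ratr q) xl; first lra.
    by exists e => // u /H; lra.
  have [r] := @rat_in_itvoo R (t - e) t ltac:(lra).
  rewrite in_itv/= => /andP[er rt]; exists (b, r, q); split => //= u.
  by move=> /andP[ru ut]; apply: H; rewrite ut (lt_trans er).
pose F i := [set w | exists t : R, [/\ lab i t, 0 < t & jumps (sample_path X w) t \/
  strictly_between (left_limit x t) (x t) (X t w)]].
apply: (@negligibleS _ _ _ _ [set w | exists i, F i w]).
  by move=> w [t [t0 /(lab_ex t t0)[i it] Ht]]; exists i; exists t.
apply: negligible_countable => i.
(* As [x] is fixed, [lab_uniq] leaves at most one deterministic time with label [i], and at that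
   time both alternatives are null. *)
have [[t [it t0]]|Ni] := pselect (exists t, lab i t /\ 0 < t); last first.
  apply: (@negligibleS _ _ _ _ set0); last exact: negligible_set0.
  by move=> w [t [it t0 _]]; apply: Ni; exists t.
apply: (@negligibleS _ _ _ _ ([set w | jumps (sample_path X w) t] `|`
  [set w | strictly_between (left_limit x t) (x t) (X t w)])).
  by move=> w [u [/(lab_uniq _ _ _ it) <- _]].
by apply: negligibleU; [exact: no_fixed_jump|exact: ax].
Qed.

End jumps_avoiding_the_support.

(* The level that a touching path jumps over is not charged at that time, and
   touching times accumulating from the left would force paths to be at such
   levels; the isolated ones are countably many deterministic times. *)
Lemma touching_negligible {R : realType} d (T : measurableType d)
    (P : {measure set T -> \bar R}) (s : R) (W : R -> T -> R)
    (touch : R -> T -> Prop) :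
  (forall v w, touch v w -> [/\ s < v, forall u, s <= u < v -> 0 < W u w,
    has_llim (W ^~ w) v 0 & 0 < W v w]) ->
  (forall v, P.-negligible [set w | touch v w]) ->
  (forall v w b, touch v w -> b < W v w ->
    P.-negligible [set w' | 0 < W v w' < b]) ->
  P.-negligible [set w | exists v, touch v w].
Proof.
move=> touchP nt gap.
apply: (@negligibleS _ _ _ _ [set w | exists b : rat, 0 < ratr b :> R /\
    exists v, touch v w /\ ratr b < W v w]).
  move=> w [v vw]; have [_ _ _ W0] := touchP _ _ vw.
  have [b] := rat_in_itvoo W0; rewrite in_itv/= => /andP[b0 bW].
  by exists b; split => //; exists v.
apply: negligible_countable => b.
pose S := [set v | exists2 w, touch v w & ratr b < W v w].
(* Touching at a time of [S] isolated from the left. For each [r] there is at most one such time, so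
   [nt] applies to it. *)
pose Iso (r : rat) := [set w | exists v, [/\ touch v w, ratr r < v, S v &
  forall u, ratr r < u < v -> ~ S u]].
pose pick (rr : rat * rat) v := [/\ ratr rr.1 < v, v < ratr rr.2 & S v].
(* One representative of [S] in each rational interval; the default [s] is harmless because [Gap]
   tests membership in [S]. *)
pose c rr := xget s (pick rr).
pose Gap rr := if asbool (S (c rr)) then [set w | 0 < W (c rr) w < ratr b] else set0.
apply: (@negligibleS _ _ _ _
    ([set w | exists r, Iso r w] `|` [set w | exists rr, Gap rr w])); last first.
  apply: negligibleU; apply: negligible_countable; [move=> r|move=> rr].
  - have [[v [rv Sv vS]]|Nv] := pselect (exists v, [/\ ratr r < v, S v &
      forall u, ratr r < u < v -> ~ S u]).
      apply: negligibleS (nt v) => w [u [tu ru Su uS]].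
      suff -> : v = u by [].
      have [vu|uv|//] := ltgtP v u.
      + by exfalso; apply: (uS v) => //; rewrite rv.
      + by exfalso; apply: (vS u) => //; rewrite ru.
    apply: (@negligibleS _ _ _ _ set0); last exact: negligible_set0.
    by move=> w [v [_ rv Sv vS]]; apply: Nv; exists v.
  - rewrite /Gap; case: asboolP => [[w tw bW]|_]; last exact: negligible_set0.
    exact: gap tw bW.
move=> w /= [b0 [v [vw bW]]].
have [sv Wpos Wl _] := touchP _ _ vw.
have [e e0 H] := has_llim_lt Wl b0.
have [u [su uv eu]] := left_point sv e0.
have [r] := rat_in_itvoo uv; rewrite in_itv/= => /andP[ur rv].
have Sv : S v by exists w.
(* If [S] meets [(r, v)], the representative [c (r, r')] is a time close enough to [v] for [W] to
   lie in [(0, b)] there, an interval not charged at that time. Otherwise [v] is isolated from the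
   left. *)
have [[a [ra av Sa]]|Na] := pselect (exists a, [/\ ratr r < a, a < v & S a]).
  right; have [r'] := rat_in_itvoo av; rewrite in_itv/= => /andP[ar' r'v].
  exists (r, r'); have [cr cr' Sc] : pick (r, r') (c (r, r')).
    by rewrite /c; apply: (@xgetI _ s (pick (r, r')) a).
  rewrite /Gap asboolT//=; move: cr cr' => /= cr cr'.
  rewrite Wpos ?H//; apply/andP; split; lra.
left; exists r; exists v; split => // a /andP[ra av] Sa.
by apply: Na; exists a.
Qed.

(** * Measurability under countable quantifiers *)

Section countable_quantifiers.
Context d (S : measurableType d).
Implicit Types A B : S -> Prop.

Lemma measurable_cst_prop (p : Prop) : measurable [set w : S | p].
Proof.
have [Hp|Np] := pselect p.
  by rewrite (_ : [set _ | _] = setT)//; apply/seteqP; split.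
by rewrite (_ : [set _ | _] = set0)//; apply/seteqP; split.
Qed.

Lemma measurable_andp A B : measurable [set w | A w] ->
  measurable [set w | B w] -> measurable [set w | A w /\ B w].
Proof. exact: measurableI. Qed.

Lemma measurable_notp A : measurable [set w | A w] ->
  measurable [set w | ~ A w].
Proof. exact: measurableC. Qed.

Lemma measurable_existsp (I : countType) (F : I -> S -> Prop) :
  (forall i, measurable [set w | F i w]) -> measurable [set w | exists i, F i w].
Proof.
move=> mF; pose G n := if unpickle n is Some i then [set w | F i w] else set0.
rewrite (_ : [set _ | _] = \bigcup_n G n); last first.
  apply/seteqP; split => [w [i Fi]|w [n _]].
    by exists (pickle i) => //; rewrite /G pickleK.
  by rewrite /G; case: unpickle => // i Fi; exists i.
by apply: bigcupT_measurable => n; rewrite /G; case: unpickle.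
Qed.

Lemma measurable_forallp (I : countType) (F : I -> S -> Prop) :
  (forall i, measurable [set w | F i w]) -> measurable [set w | forall i, F i w].
Proof.
move=> mF; rewrite (_ : [set _ | _] = [set w | ~ exists i, ~ F i w]).
  by apply/measurable_notp/measurable_existsp => i; exact: measurable_notp.
by apply/seteqP; split => w /= => [H [i]|/forallNP H i]; [|apply: contrapT].
Qed.

End countable_quantifiers.

(** * Regular grids and first passages *)

Section grids.
Context {R : realType}.
Implicit Types (x : R -> R) (s t u v d : R) (Phi : R -> R -> Prop).

Definition grid s t n i : R := s + (t - s) * (i%:R / n.+1%:R).

Lemma grid0 s t n : grid s t n 0 = s.
Proof. by rewrite /grid mul0r mulr0 addr0. Qed.

Lemma gridn s t n : grid s t n n.+1 = t.
Proof. by rewrite /grid divff ?pnatr_eq0// mulr1; lra. Qed.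

Lemma gridS s t n i : grid s t n i.+1 = grid s t n i + (t - s) / n.+1%:R.
Proof. by rewrite /grid -[in LHS]natr1; ring. Qed.

Lemma le_grid s t n i j : s <= t -> (i <= j)%N -> grid s t n i <= grid s t n j.
Proof.
move=> st ij; rewrite lerD2l ler_wpM2l ?subr_ge0//.
by rewrite ler_pM2r ?invr_gt0 ?ltr0n// ler_nat.
Qed.

Lemma lt_grid s t n i : s < t -> grid s t n i < grid s t n i.+1.
Proof. by move=> st; rewrite gridS ltrDl divr_gt0 ?subr_gt0. Qed.

Lemma grid_itv s t n i : s <= t -> (i <= n.+1)%N -> s <= grid s t n i <= t.
Proof.
move=> st ni; apply/andP; split.
  by rewrite -[leLHS](grid0 s t n) le_grid.
by rewrite -[leRHS](gridn s t n) le_grid.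
Qed.

Lemma grid_ex s t n v : s < v <= t ->
  exists2 i, (i <= n)%N & grid s t n i < v <= grid s t n i.+1.
Proof.
move=> /andP[sv vt].
have [|k vk kmin] := @ex_minnP (fun i => v <= grid s t n i).
  by exists n.+1; rewrite gridn.
case: k => [|k] in vk kmin *; first by move: vk; rewrite grid0 leNgt sv.
exists k; last by rewrite vk andbT ltNge; apply/negP => /kmin; rewrite ltnn.
by rewrite -ltnS; apply: kmin; rewrite gridn.
Qed.

Lemma grid_step s t d : 0 < d -> exists m, forall n, (m <= n)%N ->
  (t - s) / n.+1%:R < d.
Proof.
move=> d0; pose b := `|t - s| / d.
have b0 : 0 <= b by rewrite divr_ge0// ltW.
exists (Num.bound b) => n mn; rewrite ltr_pdivrMr ?ltr0n//.
apply: (le_lt_trans (ler_norm _)).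
rewrite -ltr_pdivrMl// mulrC -/b (lt_trans (archi_boundP b0))//.
by rewrite ltr_nat ltnS.
Qed.

(* On paths having a first passage, [Phi] holds between grid times squeezing
   it, for all fine grids. *)
Definition crossing s t x Phi := hits s t x /\ exists m, forall n, exists i,
  (m <= n)%N -> (i <= n)%N /\ [/\ ~ hits s (grid s t n i) x,
    hits s (grid s t n i.+1) x & Phi (grid s t n i) (grid s t n i.+1)].

(** The cell containing [v], open on the left and closed on the right, is the one on which [hits]
    turns true; for a mesh below [d] both its ends are close to [v]. *)
Lemma first_passage_crossing s t x Phi v d : s < t -> 0 < d ->
  first_passage s t x v ->
  (forall u w, s <= u -> v - d < u < v -> v <= w < v + d -> w <= t -> Phi u w) ->
  crossing s t x Phi.
Proof.
move=> st d0 [svt Nh h _ _] HPhi; split.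
  by apply: h; case/andP: svt => _ ->; rewrite lexx.
have [m Hm] := grid_step s t d0; exists m => n.
have [i ni /andP[iv vi]] := grid_ex n svt; exists i => mn; split => //.
have [si it] : s <= grid s t n i /\ grid s t n i.+1 <= t.
  have /andP[-> _] := @grid_itv s t n i (ltW st) (leqW ni).
  by have /andP[_ ->] := @grid_itv s t n i.+1 (ltW st) ni.
have step : grid s t n i.+1 < grid s t n i + d by rewrite gridS ltrD2l Hm.
split.
- by apply: Nh; rewrite si.
- by apply: h; rewrite vi.
- apply: HPhi => //; first by rewrite iv andbT; lra.
  by rewrite vi/=; lra.
Qed.

(** Conversely, [hits] fails before [v] and holds from [v] on, so a cell on which it changes must
    contain [v]. *)
Lemma crossing_first_passage s t x Phi v d : s < t -> 0 < d ->
  first_passage s t x v -> crossing s t x Phi ->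
  exists u w, [/\ s <= u, v - d < u < v, v <= w < v + d, w <= t & Phi u w].
Proof.
move=> st d0 [svt Nh h _ _] [_ [m Hm]].
have [k Hk] := grid_step s t d0; pose n := maxn m k.
have [i] := Hm n; rewrite leq_maxl => /(_ isT)[ni [Hi HSi HPhi]].
have [si it] : s <= grid s t n i /\ grid s t n i.+1 <= t.
  have /andP[-> _] := @grid_itv s t n i (ltW st) (leqW ni).
  by have /andP[_ ->] := @grid_itv s t n i.+1 (ltW st) ni.
have iSi := lt_grid n i st.
have iv : grid s t n i < v.
  rewrite ltNge; apply/negP => vi; apply/Hi/h; rewrite vi/= ltW//.
  exact: lt_le_trans it.
have vi : v <= grid s t n i.+1.
  rewrite leNgt; apply/negP => vi; apply: (Nh (grid s t n i.+1)) => //.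
  by rewrite vi andbT (le_trans si)// ltW.
have step : grid s t n i.+1 < grid s t n i + d.
  by rewrite gridS ltrD2l Hk// leq_maxr.
by exists (grid s t n i), (grid s t n i.+1); split => //; apply/andP; split; lra.
Qed.

End grids.

(** * Measurability of passage events *)

Section measurability_of_passages.
Context {R : realType} d (S : measurableType d).
Implicit Types (D : R -> S -> R) (s t u v : R).

Lemma measurable_hits D s v : s <= v ->
  (forall u, s <= u <= v -> measurable_fun setT (D u)) ->
  measurable [set w | hits s v (D ^~ w)].
Proof.
move=> sv mD; apply: measurable_andp.
  by apply: measurable_pred; apply: measurable_fun_ltr => //; apply: mD; rewrite lexx.
apply: measurable_forallp => k; rewrite (_ : [set _ | _] = [set w | exists r,
    0 <= r <= 1 /\ D (rat_time s v r) w < k.+1%:R^-1]); last first.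
  by apply/seteqP; split => w [r]; [exists r|case; exists r].
apply: measurable_existsp => r.
have [r01|r01] := boolP (0 <= r <= 1); last first.
  by rewrite (_ : [set _ | _] = set0)//; apply/seteqP; split => w // [].
apply: measurable_andp; first exact: measurable_cst_prop.
by apply: measurable_pred; apply: measurable_fun_ltr => //; apply/mD/rat_time_itv.
Qed.

Lemma measurable_dips D s v c : s <= v ->
  (forall u, s <= u <= v -> measurable_fun setT (D u)) ->
  measurable [set w | dips s v c (D ^~ w)].
Proof.
move=> sv mD; apply: measurable_andp.
  by apply: measurable_pred; apply: measurable_fun_ler => //; apply: mD; rewrite lexx.
rewrite (_ : [set _ | _] = [set w | exists r,
    0 <= r <= 1 /\ D (rat_time s v r) w < c]); last first.
  by apply/seteqP; split => w [r]; [exists r|case; exists r].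
apply: measurable_existsp => r.
have [r01|r01] := boolP (0 <= r <= 1); last first.
  by rewrite (_ : [set _ | _] = set0)//; apply/seteqP; split => w // [].
apply: measurable_andp; first exact: measurable_cst_prop.
by apply: measurable_pred; apply: measurable_fun_ltr => //; apply/mD/rat_time_itv.
Qed.

Lemma measurable_crossing D (Phi : S -> R -> R -> Prop) s t : s <= t ->
  (forall u, s <= u <= t -> measurable_fun setT (D u)) ->
  (forall u v, s <= u <= t -> s <= v <= t -> measurable [set w | Phi w u v]) ->
  measurable [set w | crossing s t (D ^~ w) (Phi w)].
Proof.
move=> st mD mPhi; have mh v : s <= v <= t ->
    measurable [set w | hits s v (D ^~ w)].
  move=> /andP[sv vt]; apply: measurable_hits => // u /andP[su uv].
  by apply: mD; rewrite su (le_trans uv).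
apply: measurable_andp; first by apply: mh; rewrite lexx st.
apply: measurable_existsp => m; apply: measurable_forallp => n.
apply: measurable_existsp => i; have [mn|mn] := leqP m n; last first.
  by rewrite (_ : [set _ | _] = setT)//; apply/seteqP; split.
have [ni|ni] := leqP i n; last first.
  by rewrite (_ : [set _ | _] = set0)//; apply/seteqP; split => // w /(_ isT)[].
have gi := @grid_itv _ s t n i st (leqW ni).
have gSi := @grid_itv _ s t n i.+1 st ni.
rewrite (_ : [set _ | _] = [set w | ~ hits s (grid s t n i) (D ^~ w) /\
  (hits s (grid s t n i.+1) (D ^~ w) /\
   Phi w (grid s t n i) (grid s t n i.+1))]); last first.
  by apply/seteqP; split => w => [/(_ isT)[_ []]|[? []]].
apply: measurable_andp; first by apply: measurable_notp; exact: mh.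
by apply: measurable_andp; [exact: mh|exact: mPhi].
Qed.

End measurability_of_passages.

(** * Integrals over varying sets *)

Section integrals_over_sets.
Context d (S : measurableType d) (R : realType) (Q : probability S R).
Implicit Types (f : S -> R) (A : set S).

Lemma integrable_on A f : measurable A ->
  Q.-integrable setT (EFin \o f) -> Q.-integrable A (EFin \o f).
Proof. by move=> mA; apply: integrableS. Qed.

(** Dominated convergence with bound [|f|]: almost surely the indicators are eventually equal to
    that of [L]. *)
Lemma cvg_Rintegral_sets f (K : nat -> set S) (L : set S) :
  Q.-integrable setT (EFin \o f) -> (forall n, measurable (K n)) ->
  measurable L ->
  Q.-negligible [set w | ~ \forall n \near \oo, K n w <-> L w] ->
  \int[Q]_(w in K n) f w @[n --> \oo] --> \int[Q]_(w in L) f w.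
Proof.
move=> intf mK mL nKL; have mf := measurable_int _ intf.
rewrite /Rintegral integral_mkcond; under eq_fun do rewrite integral_mkcond.
apply: fine_cvg; rewrite fineK; last first.
  by rewrite -integral_mkcond; apply: integrable_fin_num => //; exact: integrable_on.
have [] := @dominated_convergence _ _ _ Q setT measurableT
  (fun n => (EFin \o f) \_ (K n)) ((EFin \o f) \_ L) (fun w => `|f w|%:E) => //.
- by move=> n; apply/(measurable_restrictT _ (mK n)); exact: measurable_funTS.
- by apply/(measurable_restrictT _ mL); exact: measurable_funTS.
- apply: negligibleS nKL => w /= H H'; apply: H => _.
  apply: cvg_near_cst; near=> n; rewrite !patchE.
  have KL : K n w <-> L w by near: n.
  congr (if _ then _ else _); apply/idP/idP; rewrite !inE => /KL//.
- exact: integrable_abse intf.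
- apply: aeW => w n _; rewrite patchE; case: ifPn => _ //=.
  by rewrite normr0 lee_fin.
Unshelve. all: by end_near. Qed.

Lemma ge_Rintegral_cst f A c : measurable A ->
  Q.-integrable setT (EFin \o f) -> (forall w, A w -> c <= f w) ->
  c * fine (Q A) <= \int[Q]_(w in A) f w.
Proof.
move=> mA intf cf; rewrite -Rintegral_cst//; apply: le_Rintegral => //.
  apply: integrable_on => //; exact: finite_measure_integrable_cst.
exact: integrable_on.
Qed.

Lemma fine_measureU A B : measurable A -> measurable B -> [disjoint A & B] ->
  fine (Q (A `|` B)) = fine (Q A) + fine (Q B).
Proof.
by move=> mA mB /eqP AB; rewrite measureU// fineD ?fin_num_measure.
Qed.

Lemma le_Rintegral_pieces f (F B : nat -> set S) (a b : R) n :
  Q.-integrable setT (EFin \o f) ->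
  (forall i, measurable (F i)) -> (forall i, measurable (B i)) ->
  (forall i, B i `<=` F i) -> trivIset setT F ->
  (forall i, (i < n)%N ->
    a * fine (Q (B i)) - b * fine (Q (F i)) <= \int[Q]_(w in F i) f w) ->
  a * fine (Q (\big[setU/set0]_(i < n) B i)) -
    b * fine (Q (\big[setU/set0]_(i < n) F i)) <=
  \int[Q]_(w in \big[setU/set0]_(i < n) F i) f w.
Proof.
move=> intf mF mB BF tF; have tB : trivIset setT B.
  move=> i j _ _ [w [Biw Bjw]]; apply: tF => //.
  by exists w; split; exact: BF.
elim: n => [|n IHn] H.
  by rewrite !big_ord0 measure0 /= !mulr0 subr0 Rintegral_set0.
have mUF m : measurable (\big[setU/set0]_(i < m) F i).
  by apply: bigsetU_measurable.
have mUB m : measurable (\big[setU/set0]_(i < m) B i).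
  by apply: bigsetU_measurable.
have dF : [disjoint \big[setU/set0]_(i < n) F i & F n].
  by apply/eqP; apply: (@trivIset_bigsetUI _ predT F (sub_trivIset (@subsetT _ _) tF)).
have dB : [disjoint \big[setU/set0]_(i < n) B i & B n].
  by apply/eqP; apply: (@trivIset_bigsetUI _ predT B (sub_trivIset (@subsetT _ _) tB)).
rewrite !big_ord_recr/= (fine_measureU (mUB n) (mB n) dB).
rewrite (fine_measureU (mUF n) (mF n) dF).
rewrite (Rintegral_setU (mUF n) (mF n) _ dF); last first.
  by apply: integrable_on => //; apply: measurableU => //; exact: mUF.
have := IHn (fun i ni => H i (ltnW ni)); have := H n (ltnSn n).
rewrite !mulrDr; lra.
Qed.

End integrals_over_sets.

(** * Optional stopping along grids *)

(* [L u] is the event that the random time [sigma] has occurred by time [u];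
   the hypothesis [stop] is what optional stopping at grid times requires. *)
Section optional_stopping.
Context d (S : measurableType d) (R : realType) (Q : probability S R).
Variables (D : R -> S -> R) (s t : R) (L : R -> set S) (sigma : S -> R).
Variable N : set S.
Hypothesis st : s < t.
Hypothesis D_integrable : forall u, s <= u <= t ->
  Q.-integrable setT (EFin \o D u).
Hypothesis L_measurable : forall u, s <= u <= t -> measurable (L u).
Hypothesis L_nondecreasing : forall u v, s <= u -> u <= v -> v <= t ->
  L u `<=` L v.
Hypothesis L0 : L s = set0.
Hypothesis stop : forall u v, s <= u -> u < v -> v <= t -> forall c : R,
  let K := (L v `\` L u) `&` [set w | c <= D v w] in
  \int[Q]_(w in K) D t w = \int[Q]_(w in K) D v w.
Hypothesis N_negligible : Q.-negligible N.
Hypothesis sigmaP : forall w, ~ N w -> L t w ->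
  [/\ s <= sigma w <= t, forall u, s <= u < sigma w -> ~ L u w,
    forall u, sigma w < u <= t -> L u w,
    right_cont (D ^~ w) (sigma w) & 0 <= D (sigma w) w].

(** The event that [sigma] is discretized to the grid time [i.+1]; empty past the last cell, so that
    the family over all of [nat] is disjoint. *)
Let cell n i := if (i < n.+1)%N
  then L (grid s t n i.+1) `\` L (grid s t n i) else set0.

Let grid_in n i : (i <= n.+1)%N -> s <= grid s t n i <= t.
Proof. by apply: grid_itv; exact: ltW. Qed.

Let mD u : s <= u <= t -> measurable_fun setT (D u).
Proof. by move=> /D_integrable/measurable_int/measurable_EFinP. Qed.

Let mcell n i : measurable (cell n i).
Proof.
rewrite /cell; case: ifPn => // ni; apply: measurableD; apply: L_measurable.
  exact: grid_in.
by apply: grid_in; rewrite ltnW.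
Qed.

Let cell_disjoint n : trivIset setT (cell n).
Proof.
have H i j w : (i < j)%N -> cell n i w -> cell n j w -> False.
  rewrite /cell; case: ifPn => // ni; case: ifPn => // nj ij [Lw _] [_]; apply.
  apply: L_nondecreasing Lw.
  - by have /andP[] := @grid_in n i.+1 ni.
  - by apply: le_grid; rewrite // ltW.
  - by have /andP[] := @grid_in n j (ltnW nj).
move=> i j _ _ [w [iw jw]]; have [ij|ji|//] := ltngtP i j.
  by exfalso; exact: (H i j w).
by exfalso; exact: (H j i w).
Qed.

Let cell_ex n w : L t w -> exists2 i, (i < n.+1)%N & cell n i w.
Proof.
move=> Lt; have [|k Lk kmin] := @ex_minnP (fun i => `[< L (grid s t n i) w >]).
  by exists n.+1; rewrite gridn; exact/asboolP.
case: k => [|k] in Lk kmin *.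
  by move: Lk; rewrite grid0 L0 => /asboolP.
have kn : (k < n.+1)%N by apply: kmin; rewrite gridn; exact/asboolP.
exists k => //; rewrite /cell kn; split; first exact/asboolP.
by move=> Lk'; have := kmin k (asboolT Lk'); rewrite ltnn.
Qed.

(** The right end of the cell approximates [sigma] from the right, the side on which [D] is
    continuous. *)
Let late n (c : R) := fun i => cell n i `&` [set w | c <= D (grid s t n i.+1) w].

Let mlate n c i : measurable (late n c i).
Proof.
rewrite /late; have [ni|ni] := boolP (i < n.+1)%N; last first.
  by rewrite /cell (negbTE ni) set0I.
apply: measurableI => //; apply: measurable_pred.
by apply: measurable_fun_ler => //; apply/mD/grid_in.
Qed.

Let lateU n c := \big[setU/set0]_(i < n.+1) late n c i.

Let mlateU n c : measurable (lateU n c).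
Proof. by apply: bigsetU_measurable => i _; exact: mlate. Qed.

(** The right end of the cell of [sigma] lies in [[sigma, sigma + e)] for fine grids, where
    right-continuity keeps [D] above [c]. *)
Let near_late c : Q.-negligible [set w | ~ (L t w -> c < D (sigma w) w ->
  \forall n \near \oo, lateU n c w)].
Proof.
apply: negligibleS N_negligible => w /=; apply: contra_notP => Nw Lt cD.
have [/andP[ss st'] sN sL rc _] := sigmaP Nw Lt.
have [e e0 He] := right_cont_gt rc cD.
have [m Hm] := grid_step s t e0.
exists m => // n /= /Hm step.
have [i ni] := cell_ex n Lt; rewrite /cell ni => -[LS NL].
rewrite /lateU -bigcup_mkord; exists i => //; split.
  by rewrite /cell ni.
apply/ltW/He.
have /andP[s1 t1] := @grid_in n i.+1 ni.
have /andP[s2 t2] := @grid_in n i (ltnW ni).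
apply/andP; split.
  rewrite leNgt; apply/negP => S1; apply: (sN (grid s t n i.+1)) => //.
  by rewrite s1.
have : grid s t n i <= sigma w.
  by rewrite leNgt; apply/negP => S1; apply/NL/sL; rewrite S1.
rewrite gridS => gi; exact: ler_ltD.
Qed.

(** By [stop], on each cell [D t] integrates like its value at the right end. That value is at least
    [eta] on [late n eta] and at least [- eps] on the rest of [late n (- eps)]; the total loss is at
    most [eps] since [Q] is a probability. *)
Let late_integral (eta eps : R) n : 0 <= eta -> 0 < eps ->
  eta * fine (Q (lateU n eta)) - eps <= \int[Q]_(w in lateU n (- eps)) D t w.
Proof.
move=> eta0 eps0; have Dt : Q.-integrable setT (EFin \o D t).
  by apply: D_integrable; rewrite lexx andbT ltW.
have sub i : late n eta i `<=` late n (- eps) i.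
  by move=> w [Cw /= etaD]; split => //=; lra.
have : eta * fine (Q (lateU n eta)) - eps * fine (Q (lateU n (- eps))) <=
    \int[Q]_(w in lateU n (- eps)) D t w.
  apply: le_Rintegral_pieces => //.
    move=> i j _ _ [w [[iw _] [jw _]]]; apply: (@cell_disjoint n i j) => //.
    by exists w.
  move=> i ni; set v := grid s t n i.+1; set u := grid s t n i.
  have /andP[sv vt] : s <= v <= t := @grid_in n i.+1 ni.
  have /andP[su ut] : s <= u <= t := @grid_in n i (ltnW ni).
  have intv : Q.-integrable setT (EFin \o D v) by apply: D_integrable; rewrite sv.
  have lateE c : late n c i = (L v `\` L u) `&` [set w | c <= D v w].
    by rewrite /late /cell ni.
  have mB := mlate n eta i; have mK := mlate n (- eps) i.
  have mKB : measurable (late n (- eps) i `\` late n eta i) by exact: measurableD.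
  have KB : late n (- eps) i =
      late n eta i `|` (late n (- eps) i `\` late n eta i).
    by rewrite setDUK.
  have dKB : [disjoint late n eta i & late n (- eps) i `\` late n eta i].
    by apply/eqP; rewrite setDIK.
  have -> : \int[Q]_(w in late n (- eps) i) D t w =
      \int[Q]_(w in late n (- eps) i) D v w.
    by rewrite lateE; apply: stop => //; exact: lt_grid.
  rewrite {2}KB Rintegral_setU//; last first.
    by apply: integrable_on => //; exact: measurableU.
  have h1 : eta * fine (Q (late n eta i)) <= \int[Q]_(w in late n eta i) D v w.
    by apply: ge_Rintegral_cst => // w [].
  have h2 : - eps * fine (Q (late n (- eps) i `\` late n eta i)) <=
      \int[Q]_(w in late n (- eps) i `\` late n eta i) D v w.
    by apply: ge_Rintegral_cst => // w [[]].
  have h3 : fine (Q (late n (- eps) i `\` late n eta i)) <=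
      fine (Q (late n (- eps) i)).
    by rewrite fine_le ?fin_num_measure// le_measure ?inE.
  by nra.
apply: le_trans; rewrite lerD2l lerN2 ler_piMr//; first exact: ltW.
have mU := mlateU n (- eps).
by rewrite -lee_fin fineK ?fin_num_measure// probability_le1.
Qed.

(** Since [D] is nonnegative at [sigma], almost every point of [L t] is eventually in
    [lateU n (- eps)], while the integrand [D t] does not change with [n]. *)
Let late_cvg (eps : R) : 0 < eps ->
  \int[Q]_(w in lateU n (- eps)) D t w @[n --> \oo] --> \int[Q]_(w in L t) D t w.
Proof.
move=> eps0; have tt : s <= t <= t by rewrite lexx andbT ltW.
apply: cvg_Rintegral_sets => //; [exact: D_integrable|exact: L_measurable|].
apply: (negligibleS _ (negligibleU N_negligible (near_late (- eps)))) => w /= H.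
apply: contrapT => /not_orP[Nw /contrapT Hw]; apply: H.
have late_sub n : lateU n (- eps) w -> L t w.
  rewrite /lateU -bigcup_mkord => -[i /= ni [+ _]]; rewrite /cell ni => -[+ _].
  by apply: L_nondecreasing => //; have /andP[] := @grid_in n i.+1 ni.
have [Lt|NLt] := pselect (L t w); last first.
  by apply: nearW => n; split=> // /late_sub.
have D0 : - eps < D (sigma w) w by have [_ _ _ _] := sigmaP Nw Lt; lra.
by have := Hw Lt D0; apply: filterS => n; split.
Qed.

Lemma optional_stopping_ge0 : 0 <= \int[Q]_(w in L t) D t w.
Proof.
rewrite leNgt; apply/negP => I0; set J := Rintegral _ _ _ in I0.
(* With [eps = - J / 2] all integrals are at least [J / 2], whereas their limit is [J < J / 2]. *)
have e0 : 0 < - J / 2 by lra.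
have e1 : J < J / 2 by lra.
have /cvgr_lt/(_ _ e1)[n _ /(_ n (leqnn n))/=] := late_cvg e0.
have := @late_integral 0 _ n (lexx 0) e0; rewrite mul0r => h1 h2; lra.
Qed.

(** A Markov-type bound: [eta] times the probability of [lateU n eta] is at most [eps] plus an
    integral whose limit is nonpositive, and this set eventually contains each point with [D > eta]
    at [sigma]. *)
Lemma optional_stopping_eq0 : \int[Q]_(w in L t) D t w <= 0 ->
  Q.-negligible [set w | L t w /\ 0 < D (sigma w) w].
Proof.
move=> I0; set J := Rintegral _ _ _ in I0.
pose eta k : R := k.+1%:R^-1.
have eta0 k : 0 < eta k by rewrite invr_gt0 ltr0n.
pose F (km : nat * nat) := [set w | forall n, (km.2 <= n)%N -> lateU n (eta km.1) w].
apply: (@negligibleS _ _ _ _ ([set w | exists k, ~ (L t w ->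
    eta k < D (sigma w) w -> \forall n \near \oo, lateU n (eta k) w)] `|`
    [set w | exists km, F km w])).
  move=> w [Lt D0]; apply: contrapT => /not_orP[/forallNP H1 /forallNP H2].
  have [k] := ltr_add_invr D0; rewrite add0r => kD.
  have /contrapT/(_ Lt kD)[m _ Hm] := H1 k.
  by apply: (H2 (k, m)) => n /Hm.
apply: negligibleU; first by apply: negligible_countable => k; exact: near_late.
apply: negligible_countable => -[k m]; apply: negligible_small => e e0.
(* Half of [eta k * e] bounds the loss [eps] and half bounds the integral, so the probability is
   below [e]. *)
have e1 : 0 < eta k * e / 2 by rewrite divr_gt0 ?mulr_gt0.
have e2 : J < eta k * e / 2 by lra.
have /cvgr_lt/(_ _ e2)[n0 _ Hn0] := late_cvg e1.
pose n := maxn m n0; exists (lateU n (eta k)); split => //.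
  by move=> w /=; apply; exact: leq_maxl.
have {Hn0} := Hn0 n (leq_maxr m n0); rewrite /= => Jn.
have := late_integral n (ltW (eta0 k)) e1 => Hn.
have mU := mlateU n (eta k).
rewrite -[ltLHS]fineK ?fin_num_measure// lte_fin -(ltr_pM2l (eta0 k)); move: Jn Hn; lra.
Qed.

End optional_stopping.

Lemma probability_integral_cst {R : realType} d (T : measurableType d)
  (P : probability T R) (c : \bar R) : (\int[P]_(_ in setT) c = c)%E.
Proof.
transitivity (\int[P]_x cst c x)%E => //.
by rewrite integral_cst//= (_ : P setT = 1%E) ?mule1//; exact: probability_setT.
Qed.

(** * The difference of two independent copies as a martingale *)

Section product_martingale.
Context {R : realType} {d : measure_display} {T : measurableType d}
  {P : probability T R}.
Let Q : probability (T * T)%type R := (P \x P)%E.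
Implicit Types (V W : {RV P >-> R}) (C : set (T * T)).

Lemma integrable_snd V : P.-integrable setT (EFin \o V) ->
  Q.-integrable setT (fun z => (V z.2)%:E).
Proof.
move=> intV; have mV : measurable_fun [set: T * T] (fun z => (V z.2)%:E).
  by apply/measurable_EFinP; apply: measurableT_comp.
apply/(integrable12ltyP P P mV) => /=.
have /integrableP[_] := intV; apply: le_lt_trans.
by rewrite -[leRHS](probability_integral_cst P).
Qed.

Lemma integrable_fst V : P.-integrable setT (EFin \o V) ->
  Q.-integrable setT (fun z => (V z.1)%:E).
Proof.
move=> intV; have mV : measurable_fun [set: T * T] (fun z => (V z.1)%:E).
  by apply/measurable_EFinP; apply: measurableT_comp.
apply/(integrable21ltyP P P mV) => /=.
have /integrableP[_] := intV; apply: le_lt_trans.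
by rewrite -[leRHS](probability_integral_cst P).
Qed.

Lemma integral_snd_xsection V C : measurable C ->
  P.-integrable setT (EFin \o V) ->
  (\int[Q]_(z in C) (V z.2)%:E =
   \int[P]_x \int[P]_(y in xsection C x) (V y)%:E)%E.
Proof.
move=> mC intV; rewrite integral_mkcond -integral12_prod_meas1; last first.
  by apply/(integrable_mkcond _ mC)/(integrableS measurableT) => //; exact: integrable_snd.
apply: eq_integral => x _; rewrite /fubini_F [RHS]integral_mkcond.
by apply: eq_integral => y _; rewrite !patchE mem_xsection.
Qed.

Lemma integral_fst_ysection V C : measurable C ->
  P.-integrable setT (EFin \o V) ->
  (\int[Q]_(z in C) (V z.1)%:E =
   \int[P]_y \int[P]_(x in ysection C y) (V x)%:E)%E.
Proof.
move=> mC intV; rewrite integral_mkcond -integral21_prod_meas1; last first.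
  by apply/(integrable_mkcond _ mC)/(integrableS measurableT) => //; exact: integrable_fst.
apply: eq_integral => x _; rewrite /fubini_G [RHS]integral_mkcond.
by apply: eq_integral => y _; rewrite !patchE mem_ysection.
Qed.

Variables (F : R -> set (set T)) (X : R -> {RV P >-> R}).
Hypothesis X_martingale : martingale F X.

Definition gap (t : R) (z : T * T) : R := X t z.2 - X t z.1.

Lemma integrable_gap t : 0 <= t -> Q.-integrable setT (EFin \o gap t).
Proof.
move=> t0; have [_ /(_ t t0) intX _] := X_martingale.
rewrite (_ : EFin \o gap t =
  (fun z : T * T => (X t z.2)%:E) \- (fun z : T * T => (X t z.1)%:E))%E//.
by apply: integrableB => //; [exact: integrable_snd|exact: integrable_fst].
Qed.

(** Fubini: with one coordinate frozen, the section of [C] is in [F u], and the martingale property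
    of [X] applies to the other coordinate. *)
Lemma gap_martingale u t C : 0 <= u -> u <= t -> measurable C ->
  (forall x, F u (xsection C x)) -> (forall y, F u (ysection C y)) ->
  \int[Q]_(z in C) gap t z = \int[Q]_(z in C) gap u z.
Proof.
move=> u0 ut mC Cx Cy; have [_ intX mart] := X_martingale.
have t0 := le_trans u0 ut; have [_ _ XuXt] := mart u t u0 ut.
have I1 v : 0 <= v -> Q.-integrable C (fun z => (X v z.1)%:E).
  by move=> v0; apply: (integrableS measurableT) => //; exact/integrable_fst/intX.
have I2 v : 0 <= v -> Q.-integrable C (fun z => (X v z.2)%:E).
  by move=> v0; apply: (integrableS measurableT) => //; exact/integrable_snd/intX.
rewrite /gap !RintegralB//; try by [exact: I1|exact: I2].
congr (fine _ - fine _).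
- rewrite !integral_snd_xsection//; try exact: intX.
  by apply: eq_integral => x _; rewrite XuXt.
- rewrite !integral_fst_ysection//; try exact: intX.
  by apply: eq_integral => x _; rewrite XuXt.
Qed.

End product_martingale.

(** * What a crossing says about values and limits *)

Section crossings.
Context {R : realType}.
Implicit Types (x p : R -> R) (s t u v w l e : R) (A B : R -> Prop).

(** The left side excludes [v] and the right side includes it, as for the ends [u < v <= w] of the
    grid cell containing [v]. *)
Definition left_near v A := exists2 d : R, 0 < d & forall u, v - d < u < v -> A u.
Definition right_near v B := exists2 d : R, 0 < d & forall u, v <= u < v + d -> B u.

Lemma left_near_and v A B : left_near v A -> left_near v B ->
  left_near v (fun u => A u /\ B u).
Proof.
move=> [d d0 HA] [e e0 HB]; exists (Num.min d e); first by rewrite lt_min d0.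
move=> u /andP[du uv].
by split; [apply: HA|apply: HB]; rewrite uv andbT (le_lt_trans _ du)//
  lerD2l lerN2 ge_min lexx ?orbT.
Qed.

Lemma right_near_and v A B : right_near v A -> right_near v B ->
  right_near v (fun u => A u /\ B u).
Proof.
move=> [d d0 HA] [e e0 HB]; exists (Num.min d e); first by rewrite lt_min d0.
move=> u /andP[vu ud].
by split; [apply: HA|apply: HB]; rewrite vu/= (lt_le_trans ud)//
  lerD2l ge_min lexx ?orbT.
Qed.

Variables (s t : R) (x : R -> R) (v : R).
Hypothesis st : s < t.
Hypothesis xv : first_passage s t x v.
Implicit Types Phi : R -> R -> Prop.

Lemma crossing_intro Phi A B : left_near v A -> right_near v B ->
  (forall u w, A u -> B w -> Phi u w) -> crossing s t x Phi.
Proof.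
move=> [d d0 HA] [e e0 HB] H; apply: (@first_passage_crossing _ s t x Phi v
  (Num.min d e)) => //; first by rewrite lt_min d0.
move=> u w _ /andP[du uv] /andP[vw we] _; apply: H.
  by apply: HA; rewrite uv andbT (le_lt_trans _ du)// lerD2l lerN2 ge_min lexx.
by apply: HB; rewrite vw/= (lt_le_trans we)// lerD2l ge_min lexx orbT.
Qed.

Lemma crossing_elim Phi A B : crossing s t x Phi ->
  left_near v A -> right_near v B -> exists u w, [/\ A u, B w & Phi u w].
Proof.
move=> cPhi [d d0 HA] [e e0 HB]; have m0 : 0 < Num.min d e by rewrite lt_min d0.
have [u [w [_ /andP[du uv] /andP[vw we] _ uw]]] :=
  crossing_first_passage st m0 xv cPhi.
exists u, w; split => //.
  by apply: HA; rewrite uv andbT (le_lt_trans _ du)// lerD2l lerN2 ge_min lexx.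
by apply: HB; rewrite vw/= (lt_le_trans we)// lerD2l ge_min lexx orbT.
Qed.

(** The margin [e] persists as the cell closes in on [v]: were [l = p v], both end values would come
    within [e / 2] of it. The next three lemmas use the margin likewise. *)
Lemma crossing_jump Phi p l e : 0 < e -> has_llim p v l -> right_cont p v ->
  crossing s t x Phi -> (forall u w, Phi u w -> e < `|p w - p u|) -> l <> p v.
Proof.
move=> e0 pl pr cPhi H lpv; have e2 : 0 < e / 2 by lra.
have [u [w [hu hw /H]]] := crossing_elim cPhi (pl _ e2) (pr _ e2).
apply/negP; rewrite -leNgt.
have -> : p w - p u = (p w - p v) - (p u - l) by rewrite lpv; lra.
by rewrite (le_trans (ler_normB _ _))//; lra.
Qed.

Lemma crossing_above Phi e : 0 < e -> right_cont x v -> crossing s t x Phi ->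
  (forall u w, Phi u w -> e < x w) -> 0 < x v.
Proof.
move=> e0 xr cPhi H; rewrite ltNge; apply/negP => xv0.
have left_true : left_near v (fun=> True) by exists 1.
have xe : x v < e by lra.
have [u [w [_ hw /H]]] := crossing_elim cPhi left_true (right_cont_lt xr xe); lra.
Qed.

Lemma crossing_below Phi e : 0 < e -> right_cont x v -> crossing s t x Phi ->
  (forall u w, Phi u w -> x w < - e) -> x v < 0.
Proof.
move=> e0 xr cPhi H; rewrite ltNge; apply/negP => xv0.
have left_true : left_near v (fun=> True) by exists 1.
have xe : - e < x v by lra.
have [u [w [_ hw /H]]] := crossing_elim cPhi left_true (right_cont_gt xr xe); lra.
Qed.

Lemma crossing_from_above Phi l e : 0 < e -> has_llim x v l ->
  crossing s t x Phi -> (forall u w, Phi u w -> e < x u) -> 0 < l.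
Proof.
move=> e0 xl cPhi H; rewrite ltNge; apply/negP => xv0.
have right_true : right_near v (fun=> True) by exists 1.
have le : l < e by lra.
have [u [w [hu _ /H]]] := crossing_elim cPhi (has_llim_lt xl le) right_true; lra.
Qed.

(** End values within a quarter of the jump from their limits still differ by more than a quarter of
    it. *)
Lemma jump_near p l : has_llim p v l -> right_cont p v -> l <> p v ->
  exists2 e0 : R, 0 < e0 & exists A, exists B, [/\ left_near v A, right_near v B &
  forall u w, A u -> B w -> e0 < `|p w - p u|].
Proof.
move=> pl pr lpv; have e0 : 0 < `|p v - l| / 4.
  by rewrite divr_gt0// normr_gt0 subr_eq0; apply/eqP => /esym.
exists (`|p v - l| / 4) => //.
exists (fun u => `|p u - l| < `|p v - l| / 4),
  (fun u => `|p u - p v| < `|p v - l| / 4).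
split; [exact: pl|exact: pr|move=> u w hu hw].
have := ler_distD (p w) (p v) l; have := ler_distD (p u) (p w) l.
rewrite (distrC (p v) (p w)); lra.
Qed.

End crossings.

(** * Touching a fixed path and jumping away from it *)

Section upward_touching.
Context {R : realType} {d : measure_display} {T : measurableType d}
  {P : probability T R}.
Variable X : R -> {RV P >-> R}.
Hypothesis X_cadlag : cadlag X.
Hypothesis X_cip : continuous_in_probability X.
Hypothesis X_avoiding :
  P.-negligible [set w | ~ avoiding X (sample_path X w)].

(** Since common jumps are null, [p] may be taken continuous at [v]. Then [W v w > 0] forces the
    left limit of [X] to be [p v], so the jump starts at [p v] and its interval is not charged: the
    situation of [touching_negligible]. *)
Lemma touching_path_negligible (s t : R) (p : R -> R) (c : bool) :
  0 <= s -> cadlag_path p -> avoiding X p ->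
  let W u w := if c then X u w - p u else p u - X u w in
  P.-negligible [set w | exists v, [/\ first_passage s t (W ^~ w) v,
    jumps (sample_path X w) v & 0 < W v w]].
Proof.
move=> s0 cp ap W.
have W_llim (v : R) w : 0 < v -> has_llim (W ^~ w) v
    (if c then left_limit (sample_path X w) v - left_limit p v
     else left_limit p v - left_limit (sample_path X w) v).
  move=> v0; rewrite /W; case: c {W}; apply: has_llimB;
    by apply: cadlag_llim => //; exact: X_cadlag.
pose touch v w := [/\ avoiding X (sample_path X w), first_passage s t (W ^~ w) v,
  jumps (sample_path X w) v, ~ jumps p v & 0 < W v w].
have touch_llim v w : touch v w -> 0 < v /\ left_limit (sample_path X w) v = p v.
  move=> [_ [/andP[sv _] _ _ _ W0] jw /contrapT pv Wv].
  have v0 : 0 < v by exact: le_lt_trans sv.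
  case: W0 => [|W0]; first by rewrite leNgt Wv.
  have := has_llim_uniq W0 (W_llim v w v0); rewrite pv.
  by split => //; case: c {W W_llim touch Wv W0} H; lra.
apply: (negligibleS _ (negligibleU (common_jump_negligible X_cadlag X_cip cp ap)
  (negligibleU X_avoiding (@touching_negligible _ _ _ P s W touch _ _ _)))).
- move=> w [v [vP jw Wv]]; apply: contrapT => /not_orP[N1 /not_orP[/contrapT N2 N3]].
  apply: N3; exists v; split => // jp; apply: N1; exists v; split => //; last by left.
  by case: vP => /andP[sv _] *; exact: le_lt_trans sv.
- move=> v w tv; have [v0 _] := touch_llim v w tv.
  case: tv => _ [/andP[sv _] _ _ pos W0] jw pv Wv; split => //.
    move=> u suv; have [e e0 ue] := pos u suv.
    apply: lt_le_trans e0 (ue u _); rewrite lexx andbT.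
    by case/andP: suv.
  by case: W0 => //; rewrite leNgt Wv.
- move=> v; have [v0|v0] := ltP 0 v.
    by apply: negligibleS (no_fixed_jump X_cadlag X_cip v0) => w [].
  apply: (@negligibleS _ _ _ _ set0); last exact: negligible_set0.
  by move=> w /touch_llim[]; rewrite ltNge v0.
(* A value of [W v] in [(0, b)] puts [X v] strictly between [p v], the left limit of the path of
   [w], and the value of that path. *)
- move=> v w b tv bW; have [v0 lv] := touch_llim v w tv.
  case: tv => aw _ _ _ _; apply: negligibleS (aw v v0) => w' /=.
  rewrite /strictly_between lv /sample_path; move: bW; rewrite /W.
  case: (c) => bW /andP[h1 h2]; apply/orP; [left|right];
    by apply/andP; split; lra.
Qed.

End upward_touching.

(** * Excluded jumps of the gap at its first passage *)

Section crossings_of_the_gap.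
Context {R : realType} {d : measure_display} {T : measurableType d}
  {P : probability T R}.
Variable X : R -> {RV P >-> R}.
Hypothesis X_cadlag : cadlag X.
Hypothesis X_cip : continuous_in_probability X.
Hypothesis X_avoiding :
  P.-negligible [set w | ~ avoiding X (sample_path X w)].
Variables s t : R.
Hypothesis s0 : 0 <= s.
Hypothesis st : s < t.
Let Q : probability (T * T)%type R := (P \x P)%E.
Let traj := sample_path X.
Let D (z : T * T) : R -> R := gap X ^~ z.

(* [i] selects the copy that jumps; [up] whether the gap, vanishing in the
   limit, becomes positive, or jumps from positive to negative values. *)
Let jumper (i : bool) (z : T * T) : R -> R := traj (if i then z.2 else z.1).

Let Phi (i up : bool) (k : nat) (z : T * T) (u w : R) :=
  k.+1%:R^-1 < `|jumper i z w - jumper i z u| /\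
  if up then is_true (k.+1%:R^-1 < D z w)
  else k.+1%:R^-1 < D z u /\ D z w < - k.+1%:R^-1.

Let M i up k := [set z | crossing s t (D z) (Phi i up k z)].

Let D_rcll z : rcll (D z).
Proof. by apply: rcllB; exact/cadlag_rcll/X_cadlag. Qed.

Let D_llim z (v : R) : 0 < v ->
  has_llim (D z) v (left_limit (traj z.2) v - left_limit (traj z.1) v).
Proof. by move=> v0; apply: has_llimB; apply: cadlag_llim => //; exact: X_cadlag. Qed.

Let mX2 u : measurable_fun [set: T * T] (fun z => X u z.2).
Proof. exact: measurableT_comp. Qed.

Let mX1 u : measurable_fun [set: T * T] (fun z => X u z.1).
Proof. exact: measurableT_comp. Qed.

Lemma measurable_gap u : measurable_fun [set: T * T] (gap X u).
Proof. exact: measurable_funB. Qed.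

Let mM i up k : measurable (M i up k).
Proof.
apply: (measurable_crossing (D := gap X)) => [|u _|u v _ _].
- exact: ltW.
- exact: measurable_gap.
have mj w : measurable_fun [set: T * T] (fun z => jumper i z w).
  by case: i; [exact: mX2|exact: mX1].
apply: measurable_andp.
  apply: measurable_pred; apply: measurable_fun_ltr => //.
  by apply: measurableT_comp => //; exact: measurable_funB.
case: up; [|apply: measurable_andp]; apply: measurable_pred;
  by apply: measurable_fun_ltr => //; exact: measurable_gap.
Qed.

Let MP i up k z : M i up k z -> exists v, [/\ first_passage s t (D z) v, 0 < v,
  jumps (jumper i z) v &
  if up then is_true (0 < D z v)
  else 0 < left_limit (traj z.2) v - left_limit (traj z.1) v /\ D z v < 0].
Proof.
move=> Mz; have [hz _] := Mz.
have [|v vP] := first_passage_ex _ (@D_rcll z) hz; first by rewrite s0.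
have v0 : 0 < v by case: vP => /andP[sv _] *; exact: le_lt_trans sv.
have k0 : 0 < k.+1%:R^-1 :> R by rewrite invr_gt0 ltr0n.
have jr : right_cont (jumper i z) v.
  by apply: (cadlag_rcll _).1; [exact: X_cadlag|exact: ltW].
have Dr : right_cont (D z) v by apply: (@D_rcll z).1; exact: ltW.
exists v; split => //.
  apply: (crossing_jump st vP k0 _ jr Mz); last by move=> u w [].
  by apply: cadlag_llim => //; exact: X_cadlag.
case: up Mz => Mz.
  by apply: (crossing_above st vP k0 Dr Mz) => u w [].
split.
  by apply: (crossing_from_above st vP k0 (D_llim z v0) Mz) => u w [_ []].
by apply: (crossing_below st vP k0 Dr Mz) => u w [_ []].
Qed.

Let xsectionP (A : set (T * T)) x y : xsection A x y -> A (x, y).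
Proof. by rewrite /xsection /= inE. Qed.

Let ysectionP (A : set (T * T)) x y : ysection A y x -> A (x, y).
Proof. by rewrite /ysection /= inE. Qed.

(** The jumping copy is frozen. At the passage the other copy either jumps too or sits strictly
    inside the jump interval; [common_jump_negligible] covers both. *)
Let M_cross k i : Q (M i false k) = 0%E.
Proof.
case: i.
  apply: null_ysection => //; apply: negligibleS X_avoiding => z.
  apply: contra_not => az.
  apply: negligibleS (common_jump_negligible X_cadlag X_cip (X_cadlag z) az).
  move=> y /ysectionP/MP[v [_ v0 jz /= [l0 Dv0]]]; exists v; split => //.
  have [jy|] := pselect (jumps (traj y) v); [by left|move=> /contrapT ycont].
  right; apply/orP; right; rewrite /D /gap /= in Dv0.
  rewrite /traj /sample_path in l0 ycont *; rewrite ycont in l0.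
  by apply/andP; split; lra.
apply: null_xsection => //; apply: negligibleS X_avoiding => y.
apply: contra_not => ay.
apply: negligibleS (common_jump_negligible X_cadlag X_cip (X_cadlag y) ay).
move=> z /xsectionP/MP[v [_ v0 jz /= [l0 Dv0]]]; exists v; split => //.
have [jy|] := pselect (jumps (traj z) v); [by left|move=> /contrapT zcont].
right; apply/orP; left; rewrite /D /gap /= in Dv0.
rewrite /traj /sample_path in l0 zcont *; rewrite zcont in l0.
by apply/andP; split; lra.
Qed.

(** Here the other copy is frozen instead, and the jumping one varies. *)
Let M_touch k i : Q (M i true k) = 0%E.
Proof.
case: i.
  apply: null_xsection => //; apply: negligibleS X_avoiding => y.
  apply: contra_not => ay.
  apply: negligibleS (touching_path_negligible X_cadlag X_cip X_avoiding t true
    s0 (X_cadlag y) ay).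
  by move=> z /xsectionP/MP[v [vP _ jz Dv]]; exists v.
apply: null_ysection => //; apply: negligibleS X_avoiding => z.
apply: contra_not => az.
apply: negligibleS (touching_path_negligible X_cadlag X_cip X_avoiding t false
  s0 (X_cadlag z) az).
by move=> y /ysectionP/MP[v [vP _ jz Dv]]; exists v.
Qed.

(** In both cases the left limit of the gap differs from its value, so one of the copies jumps.
    Choosing [k] below all margins places [z] in one of the countably many null events [M]. *)
Lemma first_passage_negligible : Q.-negligible [set z | exists v l,
  [/\ first_passage s t (gap X ^~ z) v, has_llim (gap X ^~ z) v l &
    0 < gap X v z \/ 0 < l /\ gap X v z < 0]].
Proof.
apply: (@negligibleS _ _ _ _ [set z | exists iuk : bool * bool * nat,
    M iuk.1.1 iuk.1.2 iuk.2 z]); last first.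
  apply: negligible_countable => -[[i []] k] /=; apply/negligibleP => //.
    exact: M_touch.
  exact: M_cross.
move=> z [v [l [vP zl H]]].
have v0 : 0 < v by case: vP => /andP[sv _] *; exact: le_lt_trans sv.
have lE := has_llim_uniq zl (D_llim z v0).
have Dr : right_cont (D z) v by apply: (@D_rcll z).1; exact: ltW.
(* If the gap is positive at [v], the last clause of [first_passage] gives [l = 0]. *)
have l_neq : l <> gap X v z.
  case: H => [Dv|]; last lra.
  case: (vP) => _ _ _ _ [|/has_llim_uniq/(_ zl) <-]; lra.
have [i ji] : exists i, jumps (jumper i z) v.
  apply: contrapT => /forallNP Nj; apply: l_neq.
  have /contrapT jt := Nj true; have /contrapT jf := Nj false.
  rewrite /jumper in jt jf; rewrite lE jt jf; reflexivity.
have jr : right_cont (jumper i z) v.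
  by apply: (cadlag_rcll _).1; [exact: X_cadlag|exact: ltW].
have [e0 e00 [A [B [HA HB AB]]]] :=
  jump_near (cadlag_llim (X_cadlag _) v0) jr ji.
case: H => [Dv|[l0 Dv]].
  have m0 : 0 < Num.min e0 (gap X v z) by rewrite lt_min e00.
  have [k] := ltr_add_invr m0; rewrite add0r lt_min => /andP[k1 k2].
  exists (i, true, k); apply: (crossing_intro st vP HA
    (right_near_and HB (right_cont_gt Dr k2))) => u w Au [Bw Dw]; split => //=.
  exact: lt_trans k1 (AB _ _ Au Bw).
have m0 : 0 < Num.min e0 (Num.min l (- gap X v z)).
  by rewrite !lt_min e00 l0/=; lra.
have [k] := ltr_add_invr m0; rewrite add0r !lt_min => /and3P[k1 k2 k3].
have k4 : gap X v z < - k.+1%:R^-1 by rewrite ltrNr.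
exists (i, false, k); apply: (crossing_intro st vP
  (left_near_and HA (has_llim_gt zl k2))
  (right_near_and HB (right_cont_lt Dr k4))) => u w [Au Du] [Bw Dw].
by split => //=; exact: lt_trans k1 (AB _ _ Au Bw).
Qed.

End crossings_of_the_gap.

(** * Uniqueness, monotonicity and approximation of passages *)

Section unique_passage.
Context {R : realType}.
Implicit Types (x : R -> R) (s t v c : R).

Lemma first_passage_uniq x s t v w :
  first_passage s t x v -> first_passage s t x w -> v = w.
Proof.
move=> [/andP[sv vt] Nv hv _ _] [/andP[sw wt] Nw hw _ _].
have [vw|wv|//] := ltgtP v w; exfalso.
- by apply: (Nw v); [rewrite vw ltW|apply: hv; rewrite lexx].
- by apply: (Nv w); [rewrite wv ltW|apply: hw; rewrite lexx].
Qed.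

(** A path that is at least [c] before [v] and negative at [v] reaches 0 at the same time as it goes
    below [c], by a jump across 0 of the kind excluded by [first_passage_negligible]. *)
Lemma dips_negative_first_passage x s t v c : 0 <= s -> 0 < c -> rcll x ->
  c <= x s -> s <= v <= t -> (forall u, s <= u < v -> c <= x u) -> x v < 0 ->
  first_passage s t x v /\ exists l, has_llim x v l /\ 0 < l.
Proof.
move=> s0 c0 cx xs /andP[sv vt] xc xv.
have {}sv : s < v.
  by move: sv; rewrite le_eqVlt => /predU1P[sE|//]; move: xs; rewrite sE; lra.
have v0 : 0 < v by exact: le_lt_trans sv.
have [l xl] := cx.2 v v0.
split; last first.
  exists l; split => //; rewrite ltNge; apply/negP => l0.
  have lc : l < c by lra.
  have [d d0 H] := has_llim_lt xl lc; have [u [su uv du]] := left_point sv d0.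
  have := H u; rewrite du uv => /(_ isT).
  by have := xc u; rewrite (ltW su) uv => /(_ isT); lra.
split; first by rewrite sv.
- move=> u /andP[su uv]; rewrite hitsP ?s0//= => -[_ /(_ c c0)[w /andP[sw wu]]].
  by have := xc w; rewrite sw (le_lt_trans wu uv) => /(_ isT); lra.
- move=> u /andP[vu ut]; apply/hitsP => //.
    by rewrite s0 (le_trans _ vu)// ltW.
  split; first lra.
  by move=> e e0; exists v; [rewrite vu ltW|lra].
- move=> u /andP[su uv]; exists c => // w /andP[sw wu].
  by apply: xc; rewrite sw (le_lt_trans wu).
- by left; exact: ltW.
Qed.

(** If [hits] fails with [x s > 0], some threshold is never passed, and then no smaller one is; if
    it holds, [c <= x s] for small [c]. *)
Lemma dips_near_hits x s t : 0 <= s <= t -> rcll x ->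
  \forall k \near \oo, dips s t k.+1%:R^-1 x <-> hits s t x.
Proof.
move=> st cx; have [ht|Nht] := pselect (hits s t x).
  case: (ht) => xs H; have [m mx] := ltr_add_invr xs; rewrite add0r in mx.
  exists m => // k /= mk; split => // _; split; last exact: H.
  apply/ltW/(le_lt_trans _ mx).
  by rewrite lef_pV2 ?posrE ?ltr0n// ler_nat.
have [xs|xs] := leP (x s) 0.
  apply: nearW => k; split => // -[kx _]; exfalso; move: kx.
  by apply/negP; rewrite -ltNge (le_lt_trans xs)// invr_gt0 ltr0n.
have /existsNP[m Hm] : ~ forall k : nat,
    exists2 r : rat, 0 <= r <= 1 & x (rat_time s t r) < k.+1%:R^-1.
  by move=> H; apply: Nht; split.
exists m => // k /= mk; split => // -[_ [r r01 xr]]; exfalso; apply: Hm.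
exists r => //; apply: lt_le_trans xr _.
by rewrite lef_pV2 ?posrE ?ltr0n// ler_nat.
Qed.

Lemma hits_mono x s u v : 0 <= s -> s <= u -> u <= v -> rcll x ->
  hits s u x -> hits s v x.
Proof.
move=> s0 su uv cx; rewrite !hitsP ?s0 ?su//=; last exact: le_trans uv.
move=> [xs H]; split=> // c /H[w /andP[sw wu] xw]; exists w => //.
by rewrite sw (le_trans wu).
Qed.

Lemma dips_mono x s u v c : 0 <= s -> s <= u -> u <= v -> rcll x ->
  dips s u c x -> dips s v c x.
Proof.
move=> s0 su uv cx; rewrite !dipsP ?s0 ?su//=; last exact: le_trans uv.
move=> [xs [w /andP[sw wu] xw]]; split=> //; exists w => //.
by rewrite sw (le_trans wu).
Qed.

Lemma hits_start x s : ~ hits s s x.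
Proof.
move=> [xs H]; have [k xk] := ltr_add_invr xs; rewrite add0r in xk.
have [r _] := H k; rewrite /rat_time subrr mul0r addr0.
by move=> /(lt_trans xk); rewrite ltxx.
Qed.

Lemma dips_start x s c : ~ dips s s c x.
Proof.
move=> [xs [r _]]; rewrite /rat_time subrr mul0r addr0.
by rewrite ltNge xs.
Qed.

End unique_passage.

(** * The gap vanishes at its first passage *)

Section passage_of_the_gap.
Context {R : realType} {d : measure_display} {T : measurableType d}
  {P : probability T R}.
Variables (F : R -> set (set T)) (X : R -> {RV P >-> R}).
Hypothesis F_filtration : filtration F.
Hypothesis X_martingale : martingale F X.
Hypothesis X_cadlag : cadlag X.
Hypothesis X_cip : continuous_in_probability X.
Hypothesis X_avoiding :
  P.-negligible [set w | ~ avoiding X (sample_path X w)].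
Variables s t : R.
Hypothesis s0 : 0 <= s.
Hypothesis st : s < t.
Let Q : probability (T * T)%type R := (P \x P)%E.

Let gap_rcll z : rcll (gap X ^~ z).
Proof. by apply: rcllB; exact/cadlag_rcll/X_cadlag. Qed.

Let gap_right_cont z v : 0 <= v -> right_cont (gap X ^~ z) v.
Proof. exact: (@gap_rcll z).1. Qed.

(* Sections of events of the form [A (gap X ^~ z)] are events of the same form
   for [X - p] and [p - X], [p] a fixed path. *)
Let adapted_event (A : (R -> R) -> Prop) v := forall d' (S : measurableType d')
  (D : R -> S -> R), (forall u, s <= u <= v -> measurable_fun setT (D u)) ->
  measurable [set w | A (D ^~ w)].

(** [adapted_event] is instantiated first on the product space, for [K] itself, then on [T] with the
    sigma-algebra [F v], for the sections that [gap_martingale] requires. *)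
Let adapted_integral A v : s <= v <= t -> adapted_event A v ->
  let K := [set z | A (gap X ^~ z)] in
  measurable K /\ \int[Q]_(z in K) gap X t z = \int[Q]_(z in K) gap X v z.
Proof.
move=> /andP[sv vt] mA K; have mK : measurable K.
  by apply: mA => u _; exact: measurable_gap.
split=> //; have [sF _ monoF] := F_filtration; have [adX _ _] := X_martingale.
have v0 := le_trans s0 sv.
have mX u : s <= u <= v ->
    measurable_fun [set: g_sigma_algebraType (F v)] (X u).
  move=> /andP[su uv] _ B mB; rewrite setTI measurable_g_measurableTypeE//.
    by apply: (monoF u v) => //; [exact: le_trans su|apply: adX => //; exact: le_trans su].
  exact: sF.
apply: (gap_martingale X_martingale) => // [y|z].
  rewrite -[F v]measurable_g_measurableTypeE; last exact: sF.
  rewrite (_ : xsection K y = [set z | A (fun u => X u z - X u y)]); last first.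
    by apply/seteqP; split => z; rewrite /xsection /= inE.
  apply: (mA _ (g_sigma_algebraType (F v)) (fun u z => X u z - X u y)) => u suv.
  by apply: measurable_funB => //; exact: mX.
rewrite -[F v]measurable_g_measurableTypeE; last exact: sF.
rewrite (_ : ysection K z = [set y | A (fun u => X u z - X u y)]); last first.
  by apply/seteqP; split => y; rewrite /ysection /= inE.
apply: (mA _ (g_sigma_algebraType (F v)) (fun u y => X u z - X u y)) => u suv.
by apply: measurable_funB => //; exact: mX.
Qed.

Let adapted_hits u v : s <= u <= v -> adapted_event (hits s u) v.
Proof.
move=> /andP[su uv] d' S D mD; apply: measurable_hits => // w /andP[sw wu].
by apply: mD; rewrite sw (le_trans wu).
Qed.

Let adapted_dips u v c : s <= u <= v -> adapted_event (dips s u c) v.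
Proof.
move=> /andP[su uv] d' S D mD; apply: measurable_dips => // w /andP[sw wu].
by apply: mD; rewrite sw (le_trans wu).
Qed.

(** The shape of the event [K] in the hypothesis [stop], with [f] the identity for the gap and
    negation for its opposite. *)
Let adapted_stop (A B : (R -> R) -> Prop) v (f : R -> R) : s <= v ->
  measurable_fun setT f -> adapted_event A v -> adapted_event B v ->
  forall c, adapted_event (fun x => (A x /\ ~ B x) /\ c <= f (x v)) v.
Proof.
move=> sv mf mA mB c d' S D mD; apply: measurable_andp.
  by apply: measurable_andp; [exact: mA|apply/measurable_notp/mB].
apply: measurable_pred; apply: measurable_fun_ler => //.
by apply: measurableT_comp => //; apply: mD; rewrite sv lexx.
Qed.

Let N := [set z | exists v l,
  [/\ first_passage s t (gap X ^~ z) v, has_llim (gap X ^~ z) v l &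
    0 < gap X v z \/ 0 < l /\ gap X v z < 0]].

Let N_negligible : Q.-negligible N.
Proof. exact: first_passage_negligible. Qed.

(** Outside [N] the gap is nonnegative when it goes below [c], by [dips_negative_first_passage], so
    [optional_stopping_ge0] applies. *)
Let dips_integral_ge0 c : 0 < c ->
  0 <= \int[Q]_(z in [set z | dips s t c (gap X ^~ z)]) gap X t z.
Proof.
move=> c0; have /choice[sigma sigmaP] : forall z, exists v,
    dips s t c (gap X ^~ z) -> [/\ s <= v <= t,
    forall u, s <= u < v -> ~ dips s u c (gap X ^~ z),
    forall u, v < u <= t -> dips s u c (gap X ^~ z) &
    forall u, s <= u < v -> c <= gap X u z].
  move=> z; have [dz|Nd] := pselect (dips s t c (gap X ^~ z)); last by exists 0.
  have [|v vP] := dips_time _ (@gap_rcll z) dz; first by rewrite s0.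
  by exists v.
apply: (@optional_stopping_ge0 _ _ _ Q (gap X) s t
  (fun u => [set z | dips s u c (gap X ^~ z)]) sigma N) => //.
- by move=> u /andP[su _]; apply: (integrable_gap X_martingale); exact: le_trans su.
- move=> u /andP[su ut]; apply: (adapted_dips (v := u)); first by rewrite su lexx.
  by move=> v _; exact: measurable_gap.
- by move=> u v su uv vt z; apply: dips_mono => //; exact: gap_rcll.
- by apply/seteqP; split => // z /dips_start.
- move=> u v su uv vt c' K; have sv : s <= v by rewrite (le_trans su)// ltW.
  have svt : s <= v <= t by rewrite sv.
  have svv : s <= v <= v by rewrite sv lexx.
  have suv : s <= u <= v by rewrite su ltW.
  have mid : measurable_fun [set: R] (fun r : R => r) by [].
  exact: (adapted_integral svt (adapted_stop sv mid (@adapted_dips v v c svv)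
    (@adapted_dips u v c suv) c')).2.
- move=> z Nz dz; have [st' h1 h2 h3] := sigmaP z dz; split => //.
    by apply: gap_right_cont; case/andP: st' => + _; exact: le_trans.
  rewrite leNgt; apply/negP => g0; apply: Nz.
  have [cs _] := dz.
  have [fp [l [zl l0]]] :=
    dips_negative_first_passage s0 c0 (@gap_rcll z) cs st' h3 g0.
  by exists (sigma z), l; split => //; right.
Qed.

Let hits_integral_ge0 :
  0 <= \int[Q]_(z in [set z | hits s t (gap X ^~ z)]) gap X t z.
Proof.
have t0 : 0 <= t by rewrite (le_trans s0)// ltW.
have stt : s <= t <= t by rewrite lexx ltW.
have cv : \int[Q]_(z in [set z | dips s t k.+1%:R^-1 (gap X ^~ z)]) gap X t z
    @[k --> \oo] --> \int[Q]_(z in [set z | hits s t (gap X ^~ z)]) gap X t z.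
  apply: cvg_Rintegral_sets.
  - exact: (integrable_gap X_martingale).
  - move=> k; apply: (measurable_dips (D := gap X)) => [|u _]; first exact: ltW.
    exact: measurable_gap.
  - apply: (measurable_hits (D := gap X)) => [|u _]; first exact: ltW.
    exact: measurable_gap.
  - apply: (@negligibleS _ _ _ _ set0); last exact: negligible_set0.
    by move=> z /=; apply; apply: dips_near_hits; [rewrite s0 ltW|exact: gap_rcll].
rewrite leNgt; apply/negP => I0.
have /cvgr_lt/(_ _ I0)[k _ /(_ k (leqnn k))/=] := cv.
by rewrite ltNge dips_integral_ge0// invr_gt0 ltr0n.
Qed.

(** Outside [N] the opposite of the gap is nonnegative at the passage, and its integral is
    nonpositive by [hits_integral_ge0]; [optional_stopping_eq0] makes it vanish there. *)
Lemma first_passage_nonzero_negligible : Q.-negligible [set z | exists v,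
  first_passage s t (gap X ^~ z) v /\ gap X v z <> 0].
Proof.
have stt : s <= t <= t by rewrite lexx ltW.
have /choice[sigma sigmaP] : forall z, exists v,
    hits s t (gap X ^~ z) -> first_passage s t (gap X ^~ z) v.
  move=> z; have [hz|Nh] := pselect (hits s t (gap X ^~ z)); last by exists 0.
  have [|v vP] := first_passage_ex _ (@gap_rcll z) hz; first by rewrite s0.
  by exists v.
have RN (K : set (T * T)) v : s <= v -> measurable K ->
    \int[Q]_(z in K) (- gap X v z) = - \int[Q]_(z in K) gap X v z.
  move=> sv mK; under eq_Rintegral do rewrite -mulN1r.
  rewrite RintegralZl ?mulN1r//; apply: integrable_on => //.
  by apply: (integrable_gap X_martingale); exact: le_trans sv.
have hit_null : Q.-negligible [set z | hits s t (gap X ^~ z) /\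
    0 < - gap X (sigma z) z].
  apply: (@optional_stopping_eq0 _ _ _ Q (fun u z => - gap X u z) s t
    (fun u => [set z | hits s u (gap X ^~ z)]) sigma N) => //.
  - move=> u /andP[su _].
    have := integrable_gap X_martingale (le_trans s0 su).
    by move=> /integrableN; rewrite /comp; under eq_fun do rewrite -EFinN.
  - move=> u /andP[su ut]; apply: (adapted_hits (v := u)); first by rewrite su lexx.
    by move=> v _; exact: measurable_gap.
  - by move=> u v su uv vt z; apply: hits_mono => //; exact: gap_rcll.
  - by apply/seteqP; split => // z /hits_start.
  - move=> u v su uv vt c' K; have sv : s <= v by rewrite (le_trans su)// ltW.
    have svt : s <= v <= t by rewrite sv.
    have svv : s <= v <= v by rewrite sv lexx.
    have suv : s <= u <= v by rewrite su ltW.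
    have mN : measurable_fun [set: R] (fun r : R => - r) by exact: oppr_measurable.
    have [mK IK] := adapted_integral svt (adapted_stop sv mN
      (@adapted_hits v v svv) (@adapted_hits u v suv) c').
    by rewrite !RN// ?ltW//; congr (- _).
  - move=> z Nz hz; have vP := sigmaP z hz.
    have [/andP[sv vt] h1 h2 _ _] := vP.
    have v0 : 0 < sigma z by exact: le_lt_trans sv.
    have [l zl] := (@gap_rcll z).2 _ v0.
    split => //; first by rewrite ltW.
    + by move=> u /andP[su ut]; apply: h2; rewrite ltW.
    + move=> e e0; have [d' d0 H] := @gap_right_cont z _ (ltW v0) _ e0.
      by exists d' => // u /H; rewrite -opprD normrN.
    + rewrite oppr_ge0 leNgt; apply/negP => g0; apply: Nz.
      by exists (sigma z), l; split => //; left.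
  - rewrite RN; [|exact: ltW|]; first by rewrite oppr_le0 hits_integral_ge0.
    apply: (measurable_hits (D := gap X)) => [|u _]; first exact: ltW.
    exact: measurable_gap.
apply: (negligibleS _ (negligibleU N_negligible hit_null)) => z [v [vP gv]].
have [/andP[sv vt] _ h2 _ _] := vP.
have hz : hits s t (gap X ^~ z) by apply: h2; rewrite vt lexx.
have v0 : 0 < v by exact: le_lt_trans sv.
have [l zl] := (@gap_rcll z).2 _ v0.
have sE := first_passage_uniq (sigmaP z hz) vP.
have [g0|g0] := ltP 0 (gap X v z); first by left; exists v, l; split => //; left.
right; split => //; rewrite sE oppr_gt0 lt_neqAle g0 andbT.
exact/eqP.
Qed.

End passage_of_the_gap.

(** * Path space and laws of processes *)

Notation path_space R := (g_sigma_algebraType (@path_cylinders R)).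

Section path_space.
Context {R : realType}.

Lemma measurable_evaluation (u : R) : 0 <= u ->
  measurable_fun [set: (path_space R)] (fun x : path_space R => x u).
Proof.
move=> u0 _ B mB; rewrite setTI; apply: sub_sigma_algebra.
by exists u, B.
Qed.

Context {d : measure_display} {T : measurableType d} {P : probability T R}.
Implicit Types X Y : R -> {RV P >-> R}.

Lemma measurable_sample_path X :
  measurable_fun [set: T] (sample_path X : T -> (path_space R)).
Proof.
apply: (@measurability _ _ T (path_space R) setT (sample_path X)
  (@path_cylinders R)) => //.
move=> _ [_ [u [B [u0 mB ->]]] <-]; rewrite setTI.
exact: measurable_funPTI.
Qed.

Lemma measurable_path_pair X Y : measurable_fun [set: T]
  (fun w => (sample_path X w, sample_path Y w) : path_space R * path_space R).
Proof. by apply: measurable_fun_pair; exact: measurable_sample_path. Qed.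

Lemma measurable_path_event X Y (A : set (path_space R * path_space R)) :
  measurable A -> measurable [set w | A (sample_path X w, sample_path Y w)].
Proof. by move=> mA; have := measurable_path_pair X Y measurableT mA; rewrite setTI. Qed.

Definition path_rv X : {mfun T >-> (path_space R)} :=
  HB.pack (sample_path X : T -> (path_space R))
    (isMeasurableFun.Build _ _ _ _ _ (measurable_sample_path X)).

Definition path_law X : probability (path_space R) R := distribution P (path_rv X).

End path_space.

(** * Joint law of two independent processes *)

Section joint_law.
Context {R : realType} {d : measure_display} {T : measurableType d}
  {P : probability T R}.
Variable X : R -> {RV P >-> R}.
Context {d' : measure_display} {T' : measurableType d'} {P' : probability T' R}.
Variables Y Z : R -> {RV P' >-> R}.
Hypothesis YZ : independent_processes Y Z.
Hypothesis YX : same_distribution Y X.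
Hypothesis ZX : same_distribution Z X.

(** Independence and equality in law fix the joint law on rectangles, hence everywhere. This carries
    path events from an arbitrary space to the canonical copies. *)
Lemma joint_lawE (A : set (path_space R * path_space R)) : measurable A ->
  P' [set w | A (sample_path Y w, sample_path Z w)] =
  (path_law X \x path_law X)%E A.
Proof.
pose g : {mfun T' >-> (path_space R * path_space R)%type} := HB.pack
  (fun w => (sample_path Y w, sample_path Z w) : path_space R * (path_space R))
  (isMeasurableFun.Build _ _ _ _ _ (measurable_path_pair Y Z)).
move=> mA; rewrite (product_measure_unique (m' := distribution P' g))//.
move=> B C mB mC; transitivity (P' (sample_path Y @^-1` B `&` sample_path Z @^-1` C)) => //.
by rewrite (YZ mB mC) (YX mB) (ZX mC).
Qed.

End joint_law.

(** * The canonical independent copies on the product space *)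

Section independent_copies.
Context {R : realType} {d : measure_display} {T : measurableType d}
  {P : probability T R}.
Variable X : R -> {RV P >-> R}.
Let Q : probability (T * T)%type R := (P \x P)%E.

Let mX1 t : measurable_fun [set: T * T] (fun z => X t z.1).
Proof. exact: measurableT_comp. Qed.

Let mX2 t : measurable_fun [set: T * T] (fun z => X t z.2).
Proof. exact: measurableT_comp. Qed.

Definition copy1 t : {RV Q >-> R} := HB.pack (fun z : T * T => X t z.1)
  (isMeasurableFun.Build _ _ _ _ _ (mX1 t)).

Definition copy2 t : {RV Q >-> R} := HB.pack (fun z : T * T => X t z.2)
  (isMeasurableFun.Build _ _ _ _ _ (mX2 t)).

Let mpath (A : set (path_space R)) : path_sigma A -> measurable (sample_path X @^-1` A).
Proof.
move=> mA; have := measurable_sample_path X measurableT (mA : measurable A).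
by rewrite setTI.
Qed.

Lemma copy1_law : same_distribution copy1 X.
Proof.
move=> A /mpath mA; rewrite -[RHS]mule1 -(probability_setT P).
by rewrite -(product_measure1E P P mA measurableT) setXT.
Qed.

Lemma copy2_law : same_distribution copy2 X.
Proof.
move=> A /mpath mA; rewrite -[RHS]mul1e -(probability_setT P).
by rewrite -(product_measure1E P P measurableT mA) setTX.
Qed.

Lemma copies_independent : independent_processes copy1 copy2.
Proof.
move=> A B mA mB; rewrite (copy1_law mA) (copy2_law mB).
by rewrite -(product_measure1E P P (mpath mA) (mpath mB)).
Qed.

Lemma copies_independentC : independent_processes copy2 copy1.
Proof.
by move=> A B mA mB; rewrite setIC muleC; exact: copies_independent.
Qed.

End independent_copies.

(** The path is negative shortly before [v] and positive from [v] to a little after it, so rationals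
    [p < v < q] close to [v] serve. *)
Lemma sign_change_at_jump {R : realType} (x : R -> R) (v l : R) :
  0 < v -> has_llim x v l -> right_cont x v -> l < 0 -> 0 < x v ->
  exists p q : rat, [/\ 0 <= ratr p :> R, ratr p < ratr q :> R,
    x (ratr p) < 0, 0 < x (ratr q) &
    forall u, ratr p < u -> u < ratr q -> x u <> 0].
Proof.
move=> v0 xl xr l0 xv.
have [d d0 Hd] := has_llim_lt xl l0; have [e e0 He] := right_cont_gt xr xv.
have [a [a0 av da]] := left_point v0 d0.
have [p] := rat_in_itvoo av; rewrite in_itv/= => /andP[ap pv].
have ve : v < v + e by lra.
have [q] := rat_in_itvoo ve; rewrite in_itv/= => /andP[vq qe].
exists p, q; split.
- lra.
- exact: lt_trans pv vq.
- by apply: Hd; rewrite pv (lt_trans da).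
- by apply: He; rewrite qe ltW.
- move=> u pu uq; have [uv|vu] := ltP u v.
    by have := Hd u; rewrite uv (lt_trans da (lt_trans ap pu)) => /(_ isT); lra.
  by have := He u; rewrite vu (lt_trans uq qe) => /(_ isT); lra.
Qed.

(** * Almost-continuity keeps the jumps off the support *)

Section necessity.
Context {R : realType} {d : measure_display} {T : measurableType d}
  {P : probability T R}.
Variable X : R -> {RV P >-> R}.
Hypothesis X_ac : almost_continuous X.
Let Q : probability (T * T)%type R := (P \x P)%E.

Let sign_change (Y Z : R -> {RV Q >-> R}) (p q : R) :=
  [set w | [/\ Y p w < Z p w, Y q w > Z q w &
    forall u : R, p < u -> u < q -> Y u w <> Z u w]].

Let sign_changes : set (T * T) := [set z | exists pq : rat * rat,
  [/\ 0 <= ratr pq.1 :> R, ratr pq.1 < ratr pq.2 :> R &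
    sign_change (copy1 X) (copy2 X) (ratr pq.1) (ratr pq.2) z \/
    sign_change (copy2 X) (copy1 X) (ratr pq.1) (ratr pq.2) z]].

Let sign_changes_negligible : Q.-negligible sign_changes.
Proof.
apply: negligible_countable => -[p q] /=; case: X_ac => cX _ H.
have c1 : cadlag (copy1 X) by move=> z; exact: cX z.1.
have c2 : cadlag (copy2 X) by move=> z; exact: cX z.2.
have [p0|p0] := leP 0 (ratr p : R); last first.
  by apply: (@negligibleS _ _ _ _ set0) => [z []//|]; exact: negligible_set0.
have [pq|pq] := ltP (ratr p : R) (ratr q); last first.
  by apply: (@negligibleS _ _ _ _ set0) => [z []//|]; exact: negligible_set0.
have n12 := H _ _ _ _ _ c1 c2 (@copies_independent _ _ _ _ X) (@copy1_law _ _ _ _ X)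
  (@copy2_law _ _ _ _ X) _ _ p0 pq.
have n21 := H _ _ _ _ _ c2 c1 (@copies_independentC _ _ _ _ X) (@copy2_law _ _ _ _ X)
  (@copy1_law _ _ _ _ X) _ _ p0 pq.
by apply: negligibleS (negligibleU n12 n21) => z [].
Qed.

Lemma almost_continuous_jump_set :
  {ae P, forall w, jump_set (sample_path X w) `&` MSupp X = set0}.
Proof.
case: (X_ac) => cX cipX _.
have [M [mM M0 subM]] := sign_changes_negligible.
(* Almost every section of the null set [M] is null. It remains to contradict this for a path [w]
   that jumps over a point [x] of the support. *)
apply: negligibleS (null_xsection_ae mM M0) => w /= /eqP.
move=> /set0P[[t x]] [[/= t0 Hjump] [_ /= Xx]]; apply/eqP => Mw0.
(* By convention the left limit at 0 is the value there, so no jump occurs at 0. *)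
have {}t0 : 0 < t.
  rewrite lt_neqAle t0 andbT; apply/eqP => tE; move: Hjump.
  by rewrite -tE /left_limit ltxx; case=> -[]; lra.
have jnull : P.-negligible (xsection M w `|` [set y | jumps (sample_path X y) t]).
  apply: negligibleU; last exact: no_fixed_jump.
  by apply/negligibleP => //; exact: measurable_xsection.
have contra a b : a < x < b -> ~ [set y | a < X t y < b] `<=`
    xsection M w `|` [set y | jumps (sample_path X y) t].
  move=> axb sub; apply: (Supp_itvoo_gt0 Xx axb).
  apply: measure_negligible; first exact: measurable_itvoo.
  exact: negligibleS jnull.
set l := left_limit _ _ in Hjump; have wl : has_llim (sample_path X w) t l.
  exact: cadlag_llim.
have wr : right_cont (sample_path X w) t.
  by apply: (cadlag_rcll (cX w)).1; exact: ltW.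
have yl y : left_limit (sample_path X y) t = X t y ->
    has_llim (sample_path X y) t (X t y).
  by move=> <-; exact: cadlag_llim.
have yr y : right_cont (sample_path X y) t.
  by apply: (cadlag_rcll (cX y)).1; exact: ltW.
(* For [y] continuous at [t] with value in the jump interval, the path of [w] minus that of [y]
   changes sign at [t]. A downward jump exchanges the copies. *)
case: Hjump => -[h1 h2].
  apply: (contra l (X t w)) => [|y /= /andP[ly yw]]; first by rewrite h1.
  have [jy|/contrapT ycont] := pselect (jumps (sample_path X y) t); [by right|left].
  rewrite /xsection /= inE; apply: subM.
  have [||p [q [p0 pq wp wq wy]]] := sign_change_at_jump t0
    (has_llimB wl (yl y ycont)) (right_contB wr (yr y)).
  - by rewrite subr_lt0.
  - by rewrite subr_gt0.
  exists (p, q); split => //=; left; split => /=.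
  - by rewrite -subr_lt0.
  - by rewrite -subr_gt0.
  - by move=> u pu uq wyu; apply: (wy u pu uq); rewrite /sample_path wyu subrr.
apply: (contra (X t w) l) => [|y /= /andP[wy' yl']]; first by rewrite h1.
have [jy|/contrapT ycont] := pselect (jumps (sample_path X y) t); [by right|left].
rewrite /xsection /= inE; apply: subM.
have [||p [q [p0 pq wp wq wy]]] := sign_change_at_jump t0
  (has_llimB (yl y ycont) wl) (right_contB (yr y) wr).
- by rewrite subr_lt0.
- by rewrite subr_gt0.
exists (p, q); split => //=; right; split => /=.
- by rewrite -subr_lt0.
- by rewrite -subr_gt0.
- by move=> u pu uq wyu; apply: (wy u pu uq); rewrite /sample_path wyu subrr.
Qed.

End necessity.

(** * Jumps off the support give almost-continuity *)

Section sufficiency.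
Context {R : realType} {d : measure_display} {T : measurableType d}
  {P : probability T R}.
Variables (F : R -> set (set T)) (X : R -> {RV P >-> R}).
Hypothesis F_filtration : filtration F.
Hypothesis X_martingale : martingale F X.
Hypothesis X_cadlag : cadlag X.
Hypothesis X_cip : continuous_in_probability X.
Hypothesis X_jumps :
  {ae P, forall w, jump_set (sample_path X w) `&` MSupp X = set0}.
Let Q : probability (T * T)%type R := (P \x P)%E.

Let X_avoiding : P.-negligible [set w | ~ avoiding X (sample_path X w)].
Proof.
by apply: negligibleS X_jumps => w; apply: contra_not => /jump_set_avoiding.
Qed.

(** A measurable set of pairs of paths expressing, for cadlag paths, that the difference is nonzero
    at its first passage. *)
Let jump_over (s t : R) : set (path_space R * path_space R) := [set yz | exists k : nat,
  crossing s t (fun u => yz.2 u - yz.1 u)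
    (fun _ w => k.+1%:R^-1 < `|yz.2 w - yz.1 w|)].

Let measurable_jump_over s t : 0 <= s -> s < t -> measurable (jump_over s t).
Proof.
move=> s0 st; have mD u : s <= u <= t -> measurable_fun
    [set: path_space R * path_space R] (fun yz => yz.2 u - yz.1 u).
  move=> /andP[su _]; have u0 := le_trans s0 su.
  apply: measurable_funB.
    exact: measurableT_comp (measurable_evaluation u0) measurable_snd.
  exact: measurableT_comp (measurable_evaluation u0) measurable_fst.
apply: measurable_existsp => k.
apply: (measurable_crossing (D := fun u (yz : path_space R * path_space R) =>
  yz.2 u - yz.1 u)) => //; first exact: ltW.
move=> u w _ swt; apply: measurable_pred; apply: measurable_fun_ltr => //.
by apply: measurableT_comp => //; exact: mD.
Qed.

Let jump_over_null s t : 0 <= s -> s < t ->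
  (path_law X \x path_law X)%E (jump_over s t) = 0%E.
Proof.
move=> s0 st; have mJ := measurable_jump_over s0 st.
rewrite -(joint_lawE (@copies_independent _ _ _ _ X) (@copy1_law _ _ _ _ X)
  (@copy2_law _ _ _ _ X) mJ).
apply: measure_negligible; first exact: measurable_path_event.
apply: negligibleS (first_passage_nonzero_negligible F_filtration X_martingale
  X_cadlag X_cip X_avoiding s0 st) => z [k ck].
have cz : rcll (gap X ^~ z).
  by apply: rcllB; exact/cadlag_rcll/X_cadlag.
have [|v vP] := first_passage_ex _ cz ck.1; first by rewrite s0.
exists v; split => // gv0.
have v0 : 0 <= v by case: vP => /andP[sv _] *; rewrite (le_trans s0)// ltW.
have k0 : 0 < k.+1%:R^-1 :> R by rewrite invr_gt0 ltr0n.
have left_true : left_near v (fun=> True) by exists 1.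
(* If the gap vanished at [v], right-continuity would keep it below the margin [k.+1%:R^-1] at the
   right ends of fine cells. *)
have [u [w [_ gw kw]]] := crossing_elim st vP ck left_true (cz.1 v v0 _ k0).
move: gw; rewrite gv0 subr0; apply/negP; rewrite -leNgt; exact: ltW.
Qed.

Lemma jump_set_almost_continuous : almost_continuous X.
Proof.
split=> // d' T' P' Y Z cY cZ YZ YX ZX s t s0 st.
apply: (@negligibleS _ _ _ _
    [set w | jump_over s t (sample_path Y w, sample_path Z w)]); last first.
  exists [set w | jump_over s t (sample_path Y w, sample_path Z w)]; split => //.
    by apply: measurable_path_event; exact: measurable_jump_over.
  apply: etrans (jump_over_null s0 st).
  exact: (joint_lawE YZ YX ZX (measurable_jump_over s0 st)).
move=> w [/= Ys Yt YZu].
pose x u := sample_path Z w u - sample_path Y w u.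
have cx : rcll x by apply: rcllB; exact: cadlag_rcll.
have xs : 0 < x s by rewrite subr_gt0.
have xt : x t < 0 by rewrite subr_lt0.
have s0t : 0 <= s < t by rewrite s0.
have hx : hits s t x.
  apply/hitsP => //; first by rewrite s0 ltW.
  split=> // c c0; exists t; first by rewrite lexx ltW.
  exact: lt_trans xt c0.
have [v vP] := first_passage_ex s0t cx hx.
have [/andP[sv vt] _ _ _ _] := vP.
have v0 : 0 <= v by rewrite (le_trans s0)// ltW.
(* At [v = t] the difference is negative, and before [t] the paths do not meet. *)
have xv : 0 < `|x v|.
  rewrite normr_gt0; move: vt; rewrite le_eqVlt => /predU1P[->|vt].
    by rewrite lt_eqF.
  by rewrite subr_eq0; apply/eqP => /esym; exact: YZu.
(* Shortly after [v] the difference stays within half of [|x v|] of [x v], so half of [|x v|] is a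
   valid margin. *)
have [k] := ltr_add_invr (divr_gt0 xv (ltr0n R 2)); rewrite add0r => kx.
exists k; apply: (crossing_intro st vP (A := fun=> True)
  (B := fun u => `|x u - x v| < `|x v| / 2)).
- by exists 1.
- by apply: cx.1 => //; lra.
- move=> u u' _ /= hu; apply: (lt_trans kx).
  by have := ler_distD (x u') (x v) 0; rewrite !subr0 distrC -/(x u'); lra.
Qed.

End sufficiency.

Theorem lemma1p3 (R : realType) (d : measure_display) (T : measurableType d)
    (P : probability T R) (F : R -> set (set T)) (X : R -> {RV P >-> R})
    (F_filtration : filtration F) (X_martingale : martingale F X)
    (X_cadlag : cadlag X) (X_cip : continuous_in_probability X) :
  almost_continuous X <->
  {ae P, forall w, jump_set (sample_path X w) `&` MSupp X = set0}.
Proof.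
split; first exact: almost_continuous_jump_set.
exact: (jump_set_almost_continuous F_filtration).
Qed.
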